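(* Let $m\geq 2$ and $r\geq 3$ be integers. There exists a constant $a_{m,r}>0$, depending only on $m$ and $r$, such that for every integer $t\geq 2$, $$R(C^r_{2m},K^r_t)\leq a_{m,r}\left(\frac{t}{\ln t}\right)^{\frac{m}{m-1}}.$$
   Context: An $r$-graph is an $r$-uniform hypergraph. $K^r_t$ is the complete $r$-graph on $t$ vertices. $C^r_{k}$ is the $r$-uniform linear cycle of length $k$: edges $e_1,\ldots,e_k$ with $|e_i\cap e_{i+1}|=1$ for $i\in[k-1]$, $|e_k\cap e_1|=1$, and $e_i\cap e_j=\emptyset$ for all other pairs $i\neq j$. For $r$-graphs $G,H$, the Ramsey number $R(G,H)$ is the smallest positive integer $n$ such that every red/blue coloring of the edges of $K^r_n$ contains a red copy of $G$ or a blue copy of $H$. *)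

(* Defs.v *)
From mathcomp Require Import all_boot.

Set Implicit Arguments.
Unset Strict Implicit.
Unset Printing Implicit Defensive.

Record uhypergraph (r : nat) := UHypergraph {
  vertex : finType;
  edges : {set {set vertex}};
  edges_uniform : forall e, e \in edges -> #|e| = r
}.

Definition complete_edges (r t : nat) : {set {set 'I_t}} :=
  [set e : {set 'I_t} | #|e| == r].

Lemma complete_edges_uniform r t e : e \in complete_edges r t -> #|e| = r.
Proof. by rewrite inE => /eqP. Qed.

Definition complete_uhypergraph (r t : nat) : uhypergraph r :=
  UHypergraph (@complete_edges_uniform r t).

(* Edges are indexed cyclically by 'I_k, and ordS is the cyclic successor.
   The covering clause says that C has no isolated vertices. The clauses
   determine C up to isomorphism when 4 <= k; for k = 3 they do not exclude a
   vertex common to all three edges. *)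
Definition is_linear_cycle (r k : nat) (C : uhypergraph r) : Prop :=
  exists e : 'I_k -> {set vertex C},
    [/\ edges C = [set e i | i : 'I_k],
        forall v : vertex C, exists i, v \in e i,
        forall i, #|e i :&: e (ordS i)| = 1
      & forall i j, i != j -> j != ordS i -> i != ordS j ->
          e i :&: e j = set0].

Definition contains_copy (r : nat) (V : finType) (E : {set {set V}})
    (G : uhypergraph r) : Prop :=
  exists2 f : vertex G -> V,
    injective f & forall e, e \in edges G -> f @: e \in E.

(* A colouring c is only ever evaluated on the edges of the complete r-graph
   on 'I_n; true stands for red and false for blue. *)
Definition ramsey_arrow (r : nat) (G H : uhypergraph r) (n : nat) : Prop :=
  forall c : {set 'I_n} -> bool,
    contains_copy [set e in complete_edges r n | c e] G \/
    contains_copy [set e in complete_edges r n | ~~ c e] H.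

Definition is_ramsey_number (r : nat) (G H : uhypergraph r) (n : nat) : Prop :=
  [/\ 0 < n, ramsey_arrow G H n
    & forall n', 0 < n' -> ramsey_arrow G H n' -> n <= n'].

(* Linear cycles exist: block i of the vertex set 'I_k * 'I_(r - 1), together
   with the first vertex of the next block, is the i-th edge. *)
Lemma linear_cycle_exists (r k : nat) : 2 <= r -> 4 <= k ->
  exists C : uhypergraph r, is_linear_cycle k C.
Proof.
case: r => [//|[//|q]] _ k4.
pose e (i : 'I_k) : {set 'I_k * 'I_q.+1} :=
  (ordS i, ord0) |: [set (i, x) | x : 'I_q.+1].
have inE' i v : (v \in e i) = (v == (ordS i, ord0)) || (v.1 == i).
  rewrite !inE; congr orb; apply/imsetP/eqP => [[x _ ->]//|].
  by case: v => a b /= ->; exists b.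
have S1 (i : 'I_k) : ordS i != i.
  apply/eqP => /(congr1 val) /=.
  have := ltn_ord i; rewrite leq_eqVlt => /orP[/eqP h|h].
    by rewrite h modnn => h0; move: k4; rewrite -h -h0.
  by rewrite modn_small // => /eqP; rewrite eqn_leq ltnn.
have S2 (i : 'I_k) : ordS (ordS i) != i.
  apply/eqP => /(congr1 val) /=.
  have := ltn_ord i; rewrite leq_eqVlt => /orP[/eqP h|h].
    rewrite h modnn modn_small; last exact: leq_trans k4.
    by move=> h0; move: k4; rewrite -h -h0.
  rewrite (modn_small h); move: h; rewrite leq_eqVlt => /orP[/eqP h|h].
    by rewrite h modnn => h0; move: k4; rewrite -h -h0.
  by rewrite modn_small // => h0; move: (leqnSn i.+1); rewrite h0 ltnn.
have eU : forall X, X \in [set e i | i : 'I_k] -> #|X| = q.+2.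
  move=> X /imsetP[i _ ->]; rewrite cardsU1 card_imset ?card_ord.
    rewrite (_ : _ \notin _) //; apply/imsetP => -[x _ [h _]].
    by move: (S1 i); rewrite -[X in _ != X]h eqxx.
  by move=> x y [].
exists (UHypergraph eU); exists e; split => //.
- by move=> v; exists v.1; rewrite inE' eqxx orbT.
- move=> i; apply/eqP/cards1P; exists (ordS i, ord0).
  apply/setP => -[a b]; rewrite in_setI !inE' in_set1 /= !xpair_eqE.
  case: (eqVneq a (ordS i)) => [->|nai] /=.
    by rewrite (negbTE (S1 i)) orbF orbT andbT.
  rewrite orbF; case: (eqVneq a i) => //= ->.
  by rewrite eq_sym (negbTE (S2 i)).
- move=> i j ij ji jj; apply/setP => -[a b].
  rewrite in_setI !inE' in_set0 /= !xpair_eqE.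
  case: (eqVneq a i) => [->|nai] /=.
    by rewrite (negbTE ij) (negbTE jj) orbT.
  rewrite orbF; case: (eqVneq a (ordS i)) => //= ->.
  rewrite (eq_sym _ j) (negbTE ji) orbF (inj_eq (@ordS_inj k)) (negbTE ij).
  by rewrite andbF.
Qed.

(* Main.v *)
(** Call a vertex set robust if it extends to a red edge avoiding any
    prescribed bounded set of other vertices, and let the kernels be the
    minimal robust sets with at least two elements. Every red edge contains
    a kernel, every pair of vertices lies in boundedly many kernels, and a
    linear cycle of kernels extends to a red linear cycle.

    Closed walks of length 2m in the shadow graph of the kernels are
    therefore all degenerate. Janzer's homomorphism counting bounds the
    degenerate ones and gives d^2 = O(Delta n^(1/m)) for every induced
    subgraph with average degree d and maximum degree Delta. Deleting
    vertices of high degree repeatedly, with summable losses, leaves at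
    least 3n/4 vertices spanning a shadow graph of average degree
    O(n^(1/m)).

    The graph of 2-element kernels has O(n^(1+1/m)) triangles, because a
    neighbourhood contains no path on 2m - 1 vertices. A random subset of
    density about n^(-1/(2m)) then contains few triangles and few kernels of
    size at least 3; destroying them leaves a triangle-free graph of degree
    O(n^(1/(2m))) to which the Ajtai-Komlos-Szemeredi bound applies,
    producing a blue clique of order n^(1-1/m) log n. *)
Require Import Defs.
From mathcomp Require Import all_boot all_order all_algebra.
From mathcomp Require Import zify ring lra boolp reals exp.

Set Implicit Arguments.
Unset Strict Implicit.
Unset Printing Implicit Defensive.

(** * Finite sums and log-convex sequences of natural numbers *)

Lemma exists_leq_sum (I : finType) (P : pred I) (a b : I -> nat) i0 : P i0 ->
  \sum_(i | P i) a i <= \sum_(i | P i) b i -> exists2 i, P i & a i <= b i.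
Proof.
move=> Pi0 ab.
have [/existsP[i /andP[]]|] := boolP [exists i, P i && (a i <= b i)].
  by exists i.
rewrite negb_exists => /forallP b_lt_a; case/negP: (ltnn (\sum_(i | P i) b i)).
apply: leq_trans ab; rewrite (bigD1 i0) //= [leqRHS](bigD1 i0) //= -addSn.
apply: leq_add; first by have := b_lt_a i0; rewrite Pi0 -ltnNge.
apply: leq_sum => i /andP[Pi _].
by have := b_lt_a i; rewrite Pi -ltnNge => /ltnW.
Qed.

Lemma leq_card_bigcup (T I : finType) (P : pred I) (F : I -> {set T}) :
  #|\bigcup_(i | P i) F i| <= \sum_(i | P i) #|F i|.
Proof.
apply: (big_ind2 (fun (A : {set T}) b => #|A| <= b)) => [|A a B b Aa Bb|//].
  by rewrite cards0.
exact: leq_trans (leq_card_setU _ _) (leq_add Aa Bb).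
Qed.

Lemma sum_card_exchange (T U : finType) (A : {pred T}) (B : {pred U})
    (R : T -> U -> bool) :
  \sum_(x in A) #|[set y in B | R x y]| = \sum_(y in B) #|[set x in A | R x y]|.
Proof.
under eq_bigr do rewrite -sum1dep_card big_mkcondr /=.
rewrite exchange_big; apply: eq_bigr => y _.
by rewrite -sum1dep_card [RHS]big_mkcondr.
Qed.

Lemma sum_card_powerset (T : finType) (X : {set T}) :
  2 * \sum_(Y in powerset X) #|Y| = #|X| * 2 ^ #|X|.
Proof.
rewrite mul2n -addnn {2}(reindex_onto (setD X) (setD X)) /= => [|Y]; last first.
  by rewrite inE => YX; rewrite setDDr setDv set0U (setIidPr YX).
rewrite [X in _ + X](eq_bigl (mem (powerset X))) => [|Y].
  rewrite -big_split /= -card_powerset mulnC -sum_nat_const.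
  apply: eq_bigr => Y; rewrite inE => YX.
  by rewrite -(cardsID Y X) (setIidPr YX).
rewrite !inE subsetDl /=; apply/eqP/idP => [<-|YX]; first exact: subsetDl.
by rewrite setDDr setDv set0U (setIidPr YX).
Qed.

Lemma sum_nat_CauchySchwarz (I : finType) (a b : I -> nat) :
  (\sum_i a i * b i) ^ 2 <= (\sum_i a i ^ 2) * (\sum_i b i ^ 2).
Proof.
rewrite -(leq_pmul2l (isT : 0 < 2)) expnS expn1.
have -> : 2 * ((\sum_i a i * b i) * (\sum_i a i * b i)) =
    \sum_i \sum_j 2 * ((a i * b j) * (a j * b i)).
  rewrite big_distrlr /= big_distrr /=; apply: eq_bigr => i _.
  by rewrite big_distrr /=; apply: eq_bigr => j _; ring.
have -> : 2 * ((\sum_i a i ^ 2) * (\sum_i b i ^ 2)) =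
    \sum_i \sum_j ((a i * b j) ^ 2 + (a j * b i) ^ 2).
  rewrite mul2n -addnn {2}mulnC !big_distrlr /= -big_split /=.
  apply: eq_bigr => i _; rewrite -big_split /=.
  by apply: eq_bigr => j _; ring.
by apply: leq_sum => i _; apply: leq_sum => j _; apply: nat_Cauchy.
Qed.

Lemma sqr_sum_nat_le (I : finType) (a : I -> nat) :
  (\sum_i a i) ^ 2 <= #|I| * \sum_i a i ^ 2.
Proof.
have := sum_nat_CauchySchwarz (fun=> 1) a.
by under eq_bigr do rewrite mul1n; rewrite sum_nat_const muln1.
Qed.

Section LogConvex.
Variable u : nat -> nat.
Hypothesis u_logconvex : forall j, u j.+1 ^ 2 <= u j * u j.+2.

Lemma logconvex_ratio_ge j : u 1 * u j <= u 0 * u j.+1.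
Proof.
elim: j => [|j IH]; first by rewrite mulnC.
have [->|uj_gt0] := posnP (u j.+1); first by rewrite muln0.
rewrite -(leq_pmul2r uj_gt0) -mulnA mulnn.
apply: leq_trans (leq_mul (leqnn _) (u_logconvex j)) _.
by rewrite mulnA [leqRHS]mulnAC leq_mul.
Qed.

Lemma logconvex_geometric_lower j : u 1 ^ j * u 0 <= u 0 ^ j * u j.
Proof.
elim: j => [|j IH]; first by rewrite !mul1n.
rewrite !expnS -mulnA; apply: leq_trans (leq_mul (leqnn _) IH) _.
by rewrite mulnCA -mulnA [leqRHS]mulnCA leq_mul ?logconvex_ratio_ge.
Qed.

Lemma logconvex_geometric_upper D j :
  u j.+1 <= D * u j -> u j.+1 <= D ^ j.+1 * u 0.
Proof.
elim: j => [|j IH] uj_le; first by rewrite expn1.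
suff /IH u_le : u j.+1 <= D * u j.
  by apply: leq_trans uj_le _; rewrite expnS -mulnA leq_mul.
have [->//|uj_gt0] := posnP (u j.+1).
rewrite -(leq_pmul2r uj_gt0) mulnn; apply: leq_trans (u_logconvex j) _.
by rewrite mulnAC mulnC leq_mul.
Qed.
End LogConvex.

(** * Walks *)

Section Walks.
Variables (V : finType) (F : rel V).

Fixpoint walks j x y : seq (seq V) :=
  if j is j'.+1 then [seq z :: p | z <- enum (F x), p <- walks j' z y]
  else nseq (x == y) [::].

Definition nwalks j x y := size (walks j x y).

Definition nwalks_from j x := \sum_y nwalks j x y.

Definition closed_walks j := \sum_x nwalks j x x.

Lemma mem_walks j x y p :
  (p \in walks j x y) = [&& size p == j, path F x p & last x p == y].
Proof.
elim: j x p => [|j IH] x p.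
  by rewrite mem_nseq; case: p => [|z p]; case: (x == y); rewrite ?andbF.
apply/allpairsPdep/idP => [[z [q []]]|].
  rewrite mem_enum IH => Fxz /and3P[/eqP <- qF ql] ->.
  by rewrite /= eqxx (Fxz : F x z) qF.
case: p => //= z p /and3P[/eqP[sp] /andP[Fxz pF] pl].
by exists z, p; rewrite mem_enum IH sp eqxx pF.
Qed.

Lemma sum_walksS j x y (f : seq V -> nat) :
  \sum_(p <- walks j.+1 x y) f p =
  \sum_(z | F x z) \sum_(p <- walks j z y) f (z :: p).
Proof. by rewrite /= big_allpairs_dep big_enum. Qed.

Lemma sum_walksD i j x y (f : seq V -> nat) :
  \sum_(p <- walks (i + j) x y) f p =
  \sum_z \sum_(p <- walks i x z) \sum_(q <- walks j z y) f (p ++ q).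
Proof.
elim: i x f => [|i IH] x f.
  rewrite (bigD1 x) //= eqxx big_seq1 [X in _ = _ + X]big1 ?addn0 // => z zx.
  by rewrite eq_sym (negbTE zx) big_nil.
rewrite addSn sum_walksS; under [RHS]eq_bigr do rewrite sum_walksS.
by rewrite exchange_big; apply: eq_bigr => z _; rewrite IH.
Qed.

Lemma sum_closed_walks_rot i k (f : seq V -> nat) : i <= k ->
  \sum_x \sum_(p <- walks k x x) f (rot i p) =
  \sum_x \sum_(p <- walks k x x) f p.
Proof.
move=> ik; rewrite -{1}(subnKC ik) -{2}(subnK ik).
under eq_bigr do rewrite sum_walksD; rewrite exchange_big /=.
apply: eq_bigr => z _; rewrite sum_walksD; apply: eq_bigr => x _.
rewrite exchange_big; apply: eq_bigr => q _.
rewrite big_seq [RHS]big_seq; apply: eq_bigr => p.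
by rewrite mem_walks => /andP[/eqP <- _]; rewrite rot_size_cat.
Qed.

Lemma nwalksD i j x y :
  nwalks (i + j) x y = \sum_z nwalks i x z * nwalks j z y.
Proof.
rewrite /nwalks -sum1_size sum_walksD; apply: eq_bigr => z _.
under eq_bigr do rewrite sum1_size.
by rewrite big_const_seq iter_addn_0 count_predT mulnC.
Qed.

Lemma nwalks0 x y : nwalks 0 x y = (x == y).
Proof. by rewrite /nwalks size_nseq. Qed.

Lemma nwalks1 x y : nwalks 1 x y = F x y.
Proof.
rewrite /nwalks -sum1_size sum_walksS big_mkcond (bigD1 y) //= eqxx big_seq1.
rewrite big1 ?addn0; first by case: (F x y).
by move=> z zy; rewrite (negbTE zy) big_nil; case: ifP.
Qed.

Lemma nwalks_from0 x : nwalks_from 0 x = 1.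
Proof.
rewrite /nwalks_from (bigD1 x) //= nwalks0 eqxx big1 // => y yx.
by rewrite nwalks0 eq_sym (negbTE yx).
Qed.

Lemma nwalks_fromS j x : nwalks_from j.+1 x = \sum_(z | F x z) nwalks_from j z.
Proof.
rewrite /nwalks_from exchange_big; apply: eq_bigr => y _.
rewrite /nwalks -sum1_size sum_walksS; apply: eq_bigr => z _.
exact: sum1_size.
Qed.

Lemma nwalks_from1 x : nwalks_from 1 x = #|F x|.
Proof.
rewrite nwalks_fromS -sum1_card; apply: eq_bigr => y _.
exact: nwalks_from0.
Qed.

Lemma closed_walks0 : closed_walks 0 = #|V|.
Proof. by rewrite -sum1_card; apply: eq_bigr => x _; rewrite nwalks0 eqxx. Qed.

Hypothesis F_sym : symmetric F.

Lemma nwalks_sym j x y : nwalks j x y = nwalks j y x.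
Proof.
elim: j x y => [|j IH] x y; first by rewrite !nwalks0 eq_sym.
rewrite -{2}addn1 -add1n !nwalksD; apply: eq_bigr => z _.
by rewrite !nwalks1 F_sym IH mulnC.
Qed.

Lemma closed_walksD i j :
  closed_walks (i + j) = \sum_x \sum_y nwalks i x y * nwalks j x y.
Proof.
apply: eq_bigr => x _; rewrite nwalksD; apply: eq_bigr => y _.
by rewrite (nwalks_sym j).
Qed.

Lemma closed_walks_double j :
  closed_walks (2 * j) = \sum_x \sum_y nwalks j x y ^ 2.
Proof. by rewrite mul2n -addnn closed_walksD. Qed.

Lemma closed_walks_logconvex j :
  closed_walks (2 * j.+1) ^ 2 <= closed_walks (2 * j) * closed_walks (2 * j.+2).
Proof.
have -> : 2 * j.+1 = j + j.+2 by lia.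
rewrite closed_walksD !closed_walks_double !pair_bigA.
exact: sum_nat_CauchySchwarz.
Qed.

Lemma sum_nwalks_from_logconvex j :
  (\sum_x nwalks_from j.+1 x ^ 2) ^ 2 <=
  (\sum_x nwalks_from j x ^ 2) * (\sum_x nwalks_from j.+2 x ^ 2).
Proof.
suff -> : \sum_x nwalks_from j.+1 x ^ 2 =
    \sum_x nwalks_from j x * nwalks_from j.+2 x by exact: sum_nat_CauchySchwarz.
under [RHS]eq_bigr do rewrite nwalks_fromS big_distrr.
rewrite (exchange_big_dep predT) //=; apply: eq_bigr => x _.
rewrite -big_distrl /= -mulnn {1}nwalks_fromS.
by congr (_ * _); apply: eq_bigl => z; rewrite F_sym.
Qed.

(* Sidorenko's property of even cycles. *)
Lemma sum_deg_exp_le_closed_walks j : 0 < #|V| ->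
  (\sum_x #|F x|) ^ (2 * j) <= #|V| ^ (2 * j) * closed_walks (2 * j).
Proof.
move=> V_gt0; pose u i := \sum_x nwalks_from i x ^ 2.
have u0 : u 0 = #|V|.
  by rewrite -sum1_card; apply: eq_bigr => x _; rewrite nwalks_from0.
have deg_le : (\sum_x #|F x|) ^ 2 <= #|V| * u 1.
  by under eq_bigr do rewrite -nwalks_from1; exact: sqr_sum_nat_le.
have uj_le : u j <= #|V| * closed_walks (2 * j).
  rewrite closed_walks_double big_distrr; apply: leq_sum => x _ /=.
  exact: sqr_sum_nat_le.
have := logconvex_geometric_lower sum_nwalks_from_logconvex j.
rewrite -/(u 0) -/(u 1) -/(u j) u0 => u1_le.
rewrite expnM -(leq_pmul2r V_gt0).
apply: leq_trans (_ : (#|V| * u 1) ^ j * #|V| <= _).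
  by rewrite leq_mul //; case: (j) => // i; rewrite leq_exp2r.
rewrite expnMn -mulnA; apply: leq_trans (leq_mul (leqnn _) u1_le) _.
by rewrite mulnA -expnD addnn -mul2n -mulnA leq_mul // mulnC.
Qed.
End Walks.

(** * Degenerate closed walks *)

Section DegenerateClosedWalks.
Variables (V : finType) (F : rel V) (m s D : nat) (S : V -> seq V -> {set V}).
Hypothesis F_sym : symmetric F.
Hypotheses (m_gt0 : 0 < m) (s_gt0 : 0 < s).
Hypothesis deg_le : forall x, #|F x| <= D.
Hypothesis card_S : forall x p, size p = m -> path F x p -> #|S x p| <= s.

(* A closed walk is given by its successive vertices, ending at its origin. It
   is degenerate when step [m.+1] goes to one of the few vertices forbidden by
   the first [m] steps. *)
Definition degenerate p :=
  if drop m p is z :: q then z \in S (last z q) (take m p) else false.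

Hypothesis rot_degenerate : forall p, size p = 2 * m -> cycle F p ->
  exists2 i, i < 2 * m & degenerate (rot i p).

Definition ndegenerate := \sum_x \sum_(p <- walks F (2 * m) x x) degenerate p.

Definition nforbidden x y z := \sum_(p <- walks F m x y) (z \in S x p).

Lemma closed_walks_le_degenerate :
  closed_walks F (2 * m) <= 2 * m * ndegenerate.
Proof.
have -> : 2 * m * ndegenerate = \sum_x \sum_(p <- walks F (2 * m) x x)
    \sum_(i < 2 * m) degenerate (rot i p).
  under [RHS]eq_bigr do rewrite exchange_big.
  rewrite exchange_big -{1}[2 * m]card_ord -sum_nat_const.
  apply: eq_bigr => i _.
  by rewrite (sum_closed_walks_rot _ (fun p => degenerate p : nat)) // ltnW.
apply: leq_sum => x _; rewrite /nwalks -sum1_size !big_seq; apply: leq_sum => p.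
rewrite mem_walks => /and3P[/eqP sp pF /eqP pl].
have cp : cycle F p.
  by case: p pF pl {sp} => //= y q /andP[xy qF] ql; rewrite rcons_path qF ql.
have [i i_lt deg_i] := rot_degenerate sp cp.
by rewrite (bigD1 (Ordinal i_lt)) //= deg_i.
Qed.

Lemma ndegenerateE : ndegenerate =
  \sum_x \sum_y \sum_(z | F y z) nforbidden x y z * nwalks F m.-1 z x.
Proof.
apply: eq_bigr => x _; rewrite mul2n -addnn sum_walksD; apply: eq_bigr => y _.
rewrite -{2}(prednK m_gt0); under eq_bigr do rewrite sum_walksS.
rewrite exchange_big; apply: eq_bigr => z _.
rewrite big_distrl big_seq [RHS]big_seq; apply: eq_bigr => p.
rewrite mem_walks => /andP[/eqP sp _].
rewrite /nwalks -sum1_size big_distrr big_seq [RHS]big_seq /=.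
apply: eq_bigr => q; rewrite mem_walks => /and3P[_ _ /eqP ql].
by rewrite muln1 /degenerate take_size_cat // drop_size_cat // ql.
Qed.

Lemma sum_nforbidden_le x y : \sum_z nforbidden x y z <= s * nwalks F m x y.
Proof.
rewrite exchange_big /nwalks -sum1_size big_distrr !big_seq /=.
apply: leq_sum => p; rewrite mem_walks => /and3P[/eqP sp pF _].
rewrite muln1; apply: leq_trans (card_S sp pF).
by rewrite -sum1_card [leqRHS]big_mkcond leq_sum // => z _; case: ifP.
Qed.

Lemma nforbidden_le x y z : nforbidden x y z <= nwalks F m x y.
Proof. by rewrite /nwalks -sum1_size leq_sum // => p _; apply: leq_b1. Qed.

Lemma sum_sqr_nforbidden_le x y :
  \sum_(z | F y z) nforbidden x y z ^ 2 <= s * nwalks F m x y ^ 2.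
Proof.
rewrite -mulnn mulnA.
apply: leq_trans (leq_mul (sum_nforbidden_le x y) (leqnn _)).
rewrite big_mkcond big_distrl; apply: leq_sum => z _ /=.
by case: ifP => // _; rewrite -mulnn leq_mul // nforbidden_le.
Qed.

Lemma sum_sqr_nwalks_le x :
  \sum_y \sum_(z | F y z) nwalks F m.-1 z x ^ 2 <=
  D * \sum_z nwalks F m.-1 x z ^ 2.
Proof.
rewrite (exchange_big_dep predT) //= big_distrr; apply: leq_sum => z _ /=.
rewrite sum_nat_const (nwalks_sym F_sym) leq_mul //.
by apply: leq_trans (deg_le z); apply/eq_leq/eq_card => y; apply: F_sym.
Qed.

Lemma ndegenerate_AMGM l : 2 * (l * ndegenerate) <=
  s * closed_walks F (2 * m) + l ^ 2 * (D * closed_walks F (2 * m.-1)).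
Proof.
rewrite ndegenerateE !closed_walks_double // !big_distrr -big_split /=.
apply: leq_sum => x _; rewrite !big_distrr /=.
apply: leq_trans (_ : \sum_y \sum_(z | F y z)
   (nforbidden x y z ^ 2 + (l * nwalks F m.-1 z x) ^ 2) <= _).
  apply: leq_sum => y _; rewrite !big_distrr; apply: leq_sum => z _ /=.
  by rewrite [l * _]mulnCA; apply: nat_Cauchy.
under eq_bigr do rewrite big_split /=; rewrite big_split leq_add //=.
  by apply: leq_sum => y _; apply: sum_sqr_nforbidden_le.
rewrite -!big_distrr /=.
apply: leq_trans (leq_mul (leqnn _) (sum_sqr_nwalks_le x)).
rewrite big_distrr; apply: leq_sum => y _; rewrite big_distrr /=.
by apply: leq_sum => z _; rewrite expnMn.
Qed.

(* Janzer's argument for rainbow even cycles: the AM-GM weight [2 * m * s]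
   makes the first term above half of what it has to control. *)
Lemma closed_walks_le_pred : closed_walks F (2 * m) <=
  (2 * m) ^ 2 * s * D * closed_walks F (2 * m.-1).
Proof.
have k_gt0 : 0 < 2 * m by rewrite muln_gt0.
have := ndegenerate_AMGM (2 * m * s); have := closed_walks_le_degenerate.
move: (closed_walks F (2 * m.-1)) (closed_walks F (2 * m)) => w' w.
move: (2 * m) k_gt0 ndegenerate => k k_gt0 B w_le AMGM.
rewrite -(leq_pmul2l (_ : 0 < k * s)) ?muln_gt0 ?k_gt0 //.
rewrite -(leq_add2l (k * s * w)).
have -> : k * s * w + k * s * w = 2 * s * (k * w) by ring.
have -> : k * s * w + k * s * (k ^ 2 * s * D * w') =
    k * (s * w + (k * s) ^ 2 * (D * w')) by ring.
apply: leq_trans (leq_mul (leqnn k) AMGM).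
by rewrite [leqRHS](_ : _ = 2 * s * (k * (k * B))) ?leq_mul //; ring.
Qed.

Lemma sqr_sum_deg_le_of_degenerate theta : #|V| <= theta ^ m ->
  (\sum_x #|F x|) ^ 2 <= (2 * m) ^ 2 * s * D * theta * #|V| ^ 2.
Proof.
move=> V_le; have [V0|V_gt0] := posnP #|V|.
  by rewrite big_pred0 // => x; have := fintype0 x V0.
have := sum_deg_exp_le_closed_walks F_sym m V_gt0; set e := \sum_x _ => e_le.
set K := (2 * m) ^ 2 * s * D.
have w_le : closed_walks F (2 * m) <= K ^ m * #|V|.
  have := closed_walks_le_pred; rewrite -/K -(closed_walks0 F).
  case: (m) m_gt0 => // j _.
  exact: (logconvex_geometric_upper (closed_walks_logconvex F_sym)).
rewrite -(leq_exp2r _ _ m_gt0) -expnM; apply: leq_trans e_le _.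
apply: leq_trans (leq_mul (leqnn _) w_le) _.
by rewrite mulnC [leqRHS]expnMn [(K * _) ^ _]expnMn -expnM !leq_mul.
Qed.
End DegenerateClosedWalks.

(** * Sparse induced subgraphs *)

Definition nbrs (V : finType) (F : rel V) (U : {set V}) x :=
  [set y in U | F x y].

Definition deg_sum (V : finType) (F : rel V) (U : {set V}) :=
  \sum_(x in U) #|nbrs F U x|.

Definition bounded_deg (V : finType) (F : rel V) (U : {set V}) d :=
  {in U, forall x, #|nbrs F U x| <= d}.

Lemma nbrsS (V : finType) (F : rel V) (U W : {set V}) x :
  W \subset U -> nbrs F W x \subset nbrs F U x.
Proof.
by move=> WU; apply/subsetP => y; rewrite !inE => /andP[/(subsetP WU) ->].
Qed.

Lemma exists_low_deg_subset (V : finType) (F : rel V) (U : {set V}) d :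
  exists W : {set V}, [/\ W \subset U, bounded_deg F W d
    & d * #|U :\: W| <= deg_sum F U].
Proof.
exists [set x in U | #|nbrs F U x| <= d]; split.
- by apply/subsetP => x; rewrite inE => /andP[].
- move=> x; rewrite inE => /andP[_]; apply: leq_trans.
  by apply/subset_leq_card/nbrsS/subsetP => y; rewrite inE => /andP[].
pose high := [set x | d < #|nbrs F U x|].
rewrite mulnC -sum_nat_const /deg_sum [leqRHS](big_setID high).
apply: leq_trans (leq_addr _ _).
rewrite [leqLHS](eq_bigl (mem (U :&: high))) => [|x].
  by apply: leq_sum => x; rewrite !inE => /andP[_ /ltnW].
by rewrite !inE ltnNge; case: (x \in U); rewrite ?andbT ?andbF.
Qed.

Section SparseSubset.
Variables (V : finType) (F : rel V) (C theta : nat).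
Hypotheses (C_gt0 : 0 < C) (theta_gt0 : 0 < theta).
Hypothesis deg_sum_bound : forall (U : {set V}) d, bounded_deg F U d ->
  deg_sum F U ^ 2 <= C * d * theta * #|V| ^ 2.

Definition sparse_at b := exists2 U : {set V},
  4 * b * #|~: U| <= #|V| & deg_sum F U <= 1024 * C * b ^ 4 * theta * #|V|.

Lemma sparse_at_large b : #|V| <= b -> sparse_at b.
Proof.
move=> V_le; exists setT; first by rewrite setCT cards0 muln0.
apply: leq_trans (_ : \sum_(x in [set: V]) #|V| <= _).
  by apply: leq_sum => x _; apply: max_card.
rewrite sum_nat_const cardsT leq_mul //; apply: leq_trans V_le _.
have [->//|b_gt0] := posnP b.
have -> : 1024 * C * b ^ 4 * theta = b * (1024 * C * b ^ 3 * theta) by ring.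
by rewrite leq_pmulr // !muln_gt0 C_gt0 b_gt0.
Qed.

Lemma sparse_at_halve b : 0 < b -> sparse_at (2 * b) -> sparse_at b.
Proof.
move=> b_gt0 [U U_large U_sparse]; set D := 1024 * _ * _ * _ in U_sparse.
have D_gt0 : 0 < D by rewrite !muln_gt0 C_gt0 b_gt0.
have [W [WU W_deg W_large]] := exists_low_deg_subset F U (8 * b * D).
exists W.
  have UW_le : 8 * b * #|U :\: W| <= #|V|.
    rewrite -(leq_pmul2l D_gt0) mulnA [D * _]mulnC.
    exact: leq_trans U_sparse.
  have -> : ~: W = ~: U :|: (U :\: W).
    apply/setP => x; rewrite !inE.
    have [/(subsetP WU) ->//|_] := boolP (x \in W).
    by case: (x \in U).
  apply: leq_trans (leq_mul (leqnn _) (leq_card_setU _ _)) _; nia.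
rewrite -leq_sqr; apply: leq_trans (deg_sum_bound W_deg) _; rewrite /D.
have -> : C * (8 * b * (1024 * C * (2 * b) ^ 4 * theta)) * theta * #|V| ^ 2 =
  131072 * b * (C * theta * #|V| * b ^ 2) ^ 2 by ring.
have -> : (1024 * C * b ^ 4 * theta * #|V|) ^ 2 =
  131072 * b * (C * theta * #|V| * b ^ 2) ^ 2 * (8 * b ^ 3) by ring.
by rewrite leq_pmulr // !muln_gt0 b_gt0.
Qed.

(* Halving the scale from [2 ^ #|V|] down to [1], the proportions of deleted
   vertices form a geometric series. *)
Lemma exists_sparse_subset : exists2 U : {set V},
  4 * #|~: U| <= #|V| & deg_sum F U <= 1024 * C * theta * #|V|.
Proof.
have descend j : sparse_at (2 ^ j) -> sparse_at 1.
  elim: j => // j IH; rewrite expnS => /sparse_at_halve; rewrite expn_gt0.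
  by move=> /(_ isT) /IH.
have [U] : sparse_at 1 by apply/(descend #|V|)/sparse_at_large/ltnW/ltn_expl.
by rewrite !muln1; exists U.
Qed.
End SparseSubset.

(** * Graphs without a path of given length *)

Section NoPath.
Variables (V : finType) (F : rel V) (l : nat).
Hypothesis F_sym : symmetric F.

Lemma exists_path_of_min_deg (X : {set V}) : X != set0 ->
  {in X, forall x, l <= #|nbrs F X x|} ->
  exists p, [/\ size p = l, uniq p, sorted F p & {subset p <= X}].
Proof.
move=> /set0Pn[x xX] X_deg.
suff path_upto i : i <= l ->
    exists p, [/\ size p = i, uniq p, sorted F p & {subset p <= X}].
  exact: path_upto.
elim: i => [|i IH] il; first by exists [::].
have [[|y p] [sp p_uniq p_path pX]] := IH (ltnW il).
  by exists [:: x]; split => //= [|z]; [rewrite -sp|rewrite inE => /eqP ->].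
have yX : y \in X by rewrite pX ?mem_head.
have [z zN zp] : exists2 z, z \in nbrs F X y & z \notin y :: p.
  apply/subsetPn; apply/negP => /subset_leq_card /leq_trans /(_ (card_size _)).
  by rewrite sp => /(leq_trans (X_deg _ yX)); rewrite leqNgt il.
move: zN; rewrite inE => /andP[zX yz].
exists (z :: y :: p); split; first by rewrite /= -sp.
- by rewrite cons_uniq zp.
- by rewrite /= F_sym yz.
- by move=> a; rewrite inE => /predU1P[->|/pX].
Qed.

Lemma deg_sumD1_le (X : {set V}) x : x \in X ->
  deg_sum F X <= deg_sum F (X :\ x) + 2 * #|nbrs F X x|.
Proof.
move=> xX; rewrite /deg_sum (big_setD1 x) //=.
rewrite mul2n -addnn addnA addnC leq_add2r.
apply: leq_trans (_ : \sum_(y in X :\ x) (#|nbrs F (X :\ x) y| + F y x) <= _).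
  apply: leq_sum => y _.
  rewrite (cardsD1 x (nbrs F X y)) inE xX addnC leq_add2r.
  by apply/subset_leq_card/subsetP => z; rewrite !inE => /and3P[-> -> ->].
rewrite big_split leq_add2l -sum1dep_card /=.
rewrite [leqRHS]big_mkcond [leqLHS]big_mkcond /=.
apply: leq_sum => y _; rewrite !inE F_sym.
by case: (y \in X); case: (y != x); case: (F x y).
Qed.

Lemma deg_sum_le_of_no_path (X : {set V}) :
  (forall p, size p = l -> uniq p -> sorted F p -> ~ {subset p <= X}) ->
  deg_sum F X <= 2 * l * #|X|.
Proof.
have [j] := ubnP #|X|; elim: j X => // j IH X X_lt no_path.
have [->|X_neq0] := eqVneq X set0; first by rewrite /deg_sum big_set0.
have [/existsP[x /andP[xX x_deg]]|] := boolP [exists x in X, #|nbrs F X x| < l].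
  have X_card : #|X| = #|X :\ x|.+1 by rewrite (cardsD1 x) xX.
  apply: leq_trans (deg_sumD1_le xX) _.
  have : deg_sum F (X :\ x) <= 2 * l * #|X :\ x|.
    apply: IH; first by rewrite -ltnS -X_card.
    move=> p sp p_uniq p_path pX; apply: (no_path p) => // y /pX.
    by rewrite inE => /andP[].
  rewrite X_card; nia.
rewrite negb_exists => /forallP X_deg.
have [|p [sp p_uniq p_path pX]] := exists_path_of_min_deg X_neq0.
  by move=> x xX; have := X_deg x; rewrite xX -leqNgt.
by case: (no_path p).
Qed.
End NoPath.

(** * Random sampling *)

Section Sampling.
Variables (V : finType) (q' : nat).
Local Notation q := q'.+1.
Implicit Types (f : {ffun V -> 'I_q}) (A U : {set V}) (T : {set {set V}}).

(* For uniformly random [f], a random subset of density [1 / q]. *)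
Definition sample f : {set V} := [set x | f x == ord0].

Lemma card_sample_supset A :
  #|[set f | A \subset sample f]| * q ^ #|A| = q ^ #|V|.
Proof.
suff -> : #|[set f | A \subset sample f]| = q ^ #|~: A|.
  by rewrite -expnD addnC cardsC.
rewrite -[q in RHS]card_ord -(card_pffun_on (ord0 : 'I_q)).
apply: eq_card => f; rewrite inE; apply/subsetP/pffun_onP.
  move=> Af; split=> [|i //]; apply/subsetP => x /=; rewrite !inE => fx.
  by apply: contra fx => /Af; rewrite inE.
move=> [/subsetP f_supp _] x xA; rewrite inE; apply: contraTT xA => fx.
by have := f_supp x fx; rewrite inE.
Qed.

Lemma sum_card_sample_sets T j : {in T, forall A, j <= #|A|} ->
  (\sum_f #|T ::&: sample f|) * q ^ j <= #|T| * q ^ #|V|.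
Proof.
move=> T_ge; rewrite (eq_bigl (mem predT)) // sum_card_exchange.
rewrite big_distrl -sum_nat_const; apply: leq_sum => A AT /=.
by rewrite -(card_sample_supset A) leq_mul // leq_pexp2l ?T_ge.
Qed.

Lemma sum_card_sample U : (\sum_f #|U :&: sample f|) * q = #|U| * q ^ #|V|.
Proof.
rewrite (eq_bigl (mem predT)) // sum_card_exchange.
rewrite big_distrl -sum_nat_const; apply: eq_bigr => x _ /=.
rewrite -(card_sample_supset [set x]) cards1 expn1; congr (_ * _).
by apply: eq_card => f; rewrite !inE sub1set inE.
Qed.

Lemma exists_rich_sample U (P T : {set {set V}}) k :
  {in P, forall A, 2 <= #|A|} -> {in T, forall A, 3 <= #|A|} ->
  #|P| <= q * k * #|U| -> 8 * #|T| <= q ^ 2 * #|U| ->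
  exists f, 2 * k * #|U| + q * #|P ::&: sample f| +
    8 * k * q * #|T ::&: sample f| <= 4 * k * q * #|U :&: sample f|.
Proof.
move=> P_ge T_ge P_le T_le.
suff [f _ f_rich] : exists2 f, predT f & 2 * k * #|U| + q * #|P ::&: sample f| +
    8 * k * q * #|T ::&: sample f| <= 4 * k * q * #|U :&: sample f| by exists f.
apply: (@exists_leq_sum _ _ _ _ [ffun=> ord0]) => //.
rewrite !big_split /= sum_nat_const card_ffun card_ord -!big_distrr /=.
have -> : 4 * k * q * (\sum_f #|U :&: sample f|) = 4 * k * (#|U| * q ^ #|V|).
  by rewrite -sum_card_sample; ring.
move: (sum_card_sample_sets P_ge) (sum_card_sample_sets T_ge).
move: (\sum_f #|P ::&: sample f|) (\sum_f #|T ::&: sample f|) (q ^ #|V|).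
move=> p t w p_le t_le.
have {}p_le : q * p <= k * #|U| * w.
  by rewrite -(leq_pmul2r (ltn0Sn q')); nia.
have {}t_le : 8 * q * t <= #|U| * w.
  rewrite -(leq_pmul2r (_ : 0 < q ^ 2)) ?expn_gt0 //.
  apply: leq_trans (_ : 8 * (#|T| * w) <= _); last by nia.
  by apply: leq_trans (leq_mul (leqnn 8) t_le); rewrite eq_leq //; ring.
have : k * (8 * q * t) <= k * (#|U| * w) by rewrite leq_mul.
nia.
Qed.
End Sampling.

Lemma exists_sample (V : finType) (U : {set V}) (P T : {set {set V}}) q k :
  0 < q -> 0 < k ->
  {in P, forall A : {set V}, 2 <= #|A|} ->
  {in T, forall A : {set V}, 3 <= #|A|} ->
  #|P ::&: U| <= q * k * #|U| -> 8 * #|T ::&: U| <= q ^ 2 * #|U| ->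
  exists2 S : {set V}, S \subset U & [/\ #|U| <= 2 * q * #|S|,
    #|P ::&: S| <= 4 * k * #|S| & 2 * #|T ::&: S| <= #|S|].
Proof.
case: q => // q _ k_gt0 P_ge T_ge P_le T_le.
have [||//|//|f] := @exists_rich_sample V q U (P ::&: U) (T ::&: U) k.
- by move=> A; rewrite inE => /andP[/P_ge].
- by move=> A; rewrite inE => /andP[/T_ge].
have ssetIA (M : {set {set V}}) :
    M ::&: U ::&: sample f = M ::&: (U :&: sample f).
  by apply/setP => A; rewrite !inE subsetI andbA.
rewrite !ssetIA; move: (U :&: _) (subsetIl U (sample f)) => S SU S_rich.
exists S => //; split.
- by rewrite -(leq_pmul2l (_ : 0 < 2 * k)) ?muln_gt0 //; nia.
- by rewrite -(leq_pmul2l (ltn0Sn q)); nia.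
- by rewrite -(leq_pmul2l (_ : 0 < 4 * k * q.+1)) ?muln_gt0 ?k_gt0 //; nia.
Qed.

Definition avoids (V : finType) (T : {set {set V}}) (W : {set V}) :=
  {in T, forall A : {set V}, ~~ (A \subset W)}.

Lemma exists_large_subset_avoiding (V : finType) (S : {set V})
    (T : {set {set V}}) : set0 \notin T -> 2 * #|T| <= #|S| ->
  exists W : {set V}, [/\ W \subset S, #|S| <= 2 * #|W| & avoids T W].
Proof.
move=> T0 T_le; pose point (A : {set V}) := [pick x in A].
pose hit := [set x in pmap point (enum T)].
exists (S :\: hit); split=> [||A AT]; first exact: subsetDl.
  have hit_le : #|hit| <= #|T|.
    by rewrite cardsE (leq_trans (card_size _)) // cardE size_pmap count_size.
  have := cardsID hit S; have := subset_leq_card (subsetIr S hit); lia.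
have [x xA x_point] : exists2 x, x \in A & point A = Some x.
  rewrite /point; case: pickP => [x xA|A0]; first by exists x.
  case/negP: T0; rewrite -(_ : A = set0) //; apply/setP => x.
  by rewrite inE; apply: A0.
apply/subsetPn; exists x => //; rewrite !inE negb_and negbK.
by rewrite mem_pmap; apply/orP; left; apply/mapP; exists A; rewrite ?mem_enum.
Qed.

(** * Independent sets in locally independent graphs *)

Definition indep (V : finType) (G : rel V) (W : {set V}) :=
  [forall x in W, forall y in W, ~~ G x y].

Definition indep_sets (V : finType) (G : rel V) (X : {set V}) :=
  [set W in powerset X | indep G W].

Definition triangles (V : finType) (G : rel V) := [set B : {set V} |
  (#|B| == 3) && [forall x in B, forall y in B, (x != y) ==> G x y]].

Section IndependentSets.
Variables (V : finType) (G : rel V).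
Hypotheses (G_sym : symmetric G) (G_irr : irreflexive G).
Implicit Types A B K W X Y Z : {set V}.

Lemma indepP W : reflect {in W &, forall x y, ~~ G x y} (indep G W).
Proof.
apply: (iffP forall_inP) => W_indep x => [y xW yW|xW].
  exact: (forall_inP (W_indep x xW)).
by apply/forall_inP => y; apply: W_indep.
Qed.

Lemma indepS A B : A \subset B -> indep G B -> indep G A.
Proof.
move=> /subsetP AB /indepP B_indep; apply/indepP => x y /AB xB /AB yB.
exact: B_indep.
Qed.

Lemma indepU A B : indep G A -> indep G B ->
  {in A & B, forall x y, ~~ G x y} -> indep G (A :|: B).
Proof.
move=> /indepP A_indep /indepP B_indep AB_indep; apply/indepP => x y.
rewrite !inE => /orP[xA|xB] /orP[yA|yB]; first exact: A_indep.
- exact: AB_indep.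
- by rewrite G_sym AB_indep.
- exact: B_indep.
Qed.

Lemma indep_nbrs X v : v \in X -> avoids (triangles G) X ->
  indep G (nbrs G X v).
Proof.
move=> vX no_triangle; apply/indepP => x y; rewrite !inE.
move=> /andP[xX vx] /andP[yX vy]; apply/negP => xy.
have neq a b : G a b -> a != b by apply: contraTneq => ->; rewrite G_irr.
suff /no_triangle/negP[] : [set v; x; y] \in triangles G.
  by rewrite !subUset !sub1set vX xX yX.
rewrite inE -setUA cardsU1 !inE negb_or !neq //= cards2 neq //=.
apply/forall_inP => a aB; apply/forall_inP => b bB; apply/implyP.
by move: aB bB; rewrite !inE => /or3P[] /eqP-> /or3P[] /eqP-> //;
  rewrite ?eqxx // G_sym.
Qed.

Lemma sum_indep_sets_split X B (f : {set V} -> nat) : B \subset X ->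
  \sum_(W in indep_sets G X) f W = \sum_(K in indep_sets G (X :\: B))
    \sum_(Z in powerset B | indep G (K :|: Z)) f (K :|: Z).
Proof.
move=> BX; rewrite (partition_big (fun W => W :\: B)
  (mem (indep_sets G (X :\: B)))) /=.
  apply: eq_bigr => K; rewrite !inE subsetD => /andP[/andP[KX KB] _].
  rewrite (reindex_onto (setU K) (fun W => W :&: B)) /=; last first.
    by move=> W /andP[_ /eqP <-]; rewrite setUC setID.
  apply: eq_bigl => Z; rewrite !inE subUset KX setDUl setIUl.
  have -> : K :&: B = set0 by apply/eqP; rewrite setI_eq0.
  have -> : K :\: B = K by apply/setDidPl.
  rewrite set0U; apply/idP/idP => [/andP[/andP[/andP[_ ->] _] /eqP <-]|].
    by rewrite subsetIr.
  case/andP=> ZB ->; rewrite (subset_trans ZB BX) (setIidPl ZB) eqxx andbT.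
  by rewrite (_ : Z :\: B = set0) ?setU0 ?eqxx //; apply/eqP; rewrite setD_eq0.
move=> W; rewrite !inE => /andP[WX W_indep].
by rewrite setSD //= (indepS _ W_indep) ?subsetDl.
Qed.

Section LocallyIndependent.
Variables (X : {set V}) (D L : nat).
Hypothesis X_nbrs_indep : {in X, forall v, indep G (nbrs G X v)}.
Hypothesis X_deg : bounded_deg G X D.
Hypothesis L_le : 2 ^ (5 * L) <= D.

Definition free_nbrs v K := [set y in nbrs G X v | [forall x in K, ~~ G x y]].

Lemma indep_extensions v K Z : v \in X ->
  K \in indep_sets G (X :\: (v |: nbrs G X v)) ->
  (Z \in powerset (v |: nbrs G X v)) && indep G (K :|: Z) =
  (Z \in [set v] |: powerset (free_nbrs v K)).
Proof.
move=> vX; rewrite !inE subsetD => /andP[/andP[KX K_disj] K_indep].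
set N := nbrs G X v in K_disj *.
have KN x : x \in K -> x \notin v |: N.
  by move=> xK; rewrite (disjointFr K_disj xK).
apply/andP/orP=> [[ZN KZ_indep]|[/eqP->|/subsetP Z_free]].
- have [vZ|vZ] := boolP (v \in Z); [left|right].
    rewrite eqEsubset sub1set vZ andbT; apply/subsetP => z zZ.
    have : ~~ G v z by apply: (indepP _ KZ_indep); rewrite inE ?vZ ?zZ orbT.
    by have := subsetP ZN _ zZ; rewrite !inE => /orP[//|/andP[_ ->]].
  apply/subsetP => z zZ; rewrite !inE.
  have := subsetP ZN _ zZ; rewrite !inE.
  case: eqVneq vZ => [<-|_ _ /= ->]; first by rewrite zZ.
  apply/forall_inP => x xK.
  by apply: (indepP _ KZ_indep); rewrite inE ?xK ?zZ ?orbT.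
- split; first by rewrite sub1set setU11.
  apply: indepU => // [|x y xK /set1P->].
    by apply/indepP => x y /set1P-> /set1P->; rewrite G_irr.
  have := KN _ xK; rewrite !inE negb_or (subsetP KX _ xK) /= G_sym.
  by case/andP.
- have ZN : Z \subset N by apply/subsetP => z /Z_free; rewrite inE => /andP[].
  split; first by rewrite (subset_trans ZN) ?subsetUr.
  apply: indepU => // [|x z xK /Z_free].
    exact: indepS ZN (X_nbrs_indep vX).
  by rewrite inE => /andP[_ /forall_inP]; apply.
Qed.

Lemma sum_indep_extensions v K (f : {set V} -> nat) : v \in X ->
  K \in indep_sets G (X :\: (v |: nbrs G X v)) ->
  \sum_(Z in powerset (v |: nbrs G X v) | indep G (K :|: Z)) f Z =
  f [set v] + \sum_(Y in powerset (free_nbrs v K)) f Y.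
Proof.
move=> vX KI; rewrite (eq_bigl _ _ (fun Z => indep_extensions Z vX KI)).
by rewrite big_setU1 //= powersetE sub1set !inE G_irr andbF.
Qed.

Lemma exp_weight_le x : 2 * L * (2 ^ x).+1 <= 2 * D + x * 2 ^ x.
Proof.
have [Lx|xL] := leqP (4 * L) x.
  have : 0 < 2 ^ x by rewrite expn_gt0.
  have : 4 * L * 2 ^ x <= x * 2 ^ x by rewrite leq_mul.
  nia.
apply: leq_trans (leq_addr _ _); rewrite -mulnA leq_mul //.
apply: leq_trans L_le.
have -> : 5 * L = L + 4 * L by lia.
by rewrite expnD leq_mul ?ltn_exp2l //; apply/ltnW/ltn_expl.
Qed.

Lemma indep_sets_local_weight v : v \in X -> L * #|indep_sets G X| <=
  \sum_(W in indep_sets G X) (D * (v \in W) + #|nbrs G X v :&: W|).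
Proof.
move=> vX; set N := nbrs G X v.
have NX : v |: N \subset X.
  by rewrite subUset sub1set vX; apply/subsetP => y; rewrite inE => /andP[].
rewrite mulnC -sum_nat_const !(sum_indep_sets_split _ NX).
apply: leq_sum => K KI; set free := free_nbrs v K.
have free_sub : free \subset N by apply/subsetP => y; rewrite inE => /andP[].
rewrite (sum_indep_extensions (fun=> L)) // sum_nat_const card_powerset.
rewrite (sum_indep_extensions
  (fun Z => D * (v \in K :|: Z) + #|N :&: (K :|: Z)|)) //.
rewrite -(leq_pmul2l (isT : 0 < 2)).
have -> : 2 * (L + 2 ^ #|free| * L) = 2 * L * (2 ^ #|free|).+1 by ring.
apply: leq_trans (exp_weight_le _) _.
rewrite -sum_card_powerset mulnDr leq_add //.
  by rewrite !inE eqxx orbT muln1 leq_mul // leq_addr.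
rewrite leq_mul // leq_sum // => Y; rewrite inE => Y_free.
apply: leq_trans (leq_addl _ _); apply: subset_leq_card.
by rewrite subsetI (subset_trans Y_free) ?subsetUr.
Qed.

(* The average size of a uniformly random independent set (Alon's proof of the
   Ajtai-Komlos-Szemeredi bound). *)
Lemma exists_large_indep : exists2 W : {set V},
  W \in indep_sets G X & L * #|X| <= 2 * D * #|W|.
Proof.
apply: (@exists_leq_sum _ _ _ _ set0).
  by rewrite inE powersetE sub0set; apply/indepP => x y; rewrite inE.
apply: leq_trans (_ : \sum_(v in X) \sum_(W in indep_sets G X)
    (D * (v \in W) + #|nbrs G X v :&: W|) <= _).
  rewrite sum_nat_const mulnCA [_ * #|X|]mulnC mulnCA -sum_nat_const.
  by apply: leq_sum => v; apply: indep_sets_local_weight.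
rewrite exchange_big; apply: leq_sum => W; rewrite !inE => /andP[WX _].
rewrite big_split /= -mulnA mul2n -addnn leq_add //.
  rewrite -big_distrr leq_mul //= -sum1_card big_mkcond [leqRHS]big_mkcond.
  by apply: leq_sum => v _; case: (v \in X); case: (v \in W).
rewrite mulnC -sum_nat_const.
apply: leq_trans (_ : \sum_(v in X) #|[set w in W | G v w]| <= _).
  apply: leq_sum => v _; apply/subset_leq_card/subsetP => w.
  by rewrite !inE => /andP[/andP[_ ->] ->].
rewrite sum_card_exchange; apply: leq_sum => w wW.
apply: leq_trans (X_deg (subsetP WX _ wW)); rewrite eq_leq //.
by apply: eq_card => v; rewrite !inE G_sym.
Qed.
End LocallyIndependent.
End IndependentSets.

(** * Cyclic patterns and linear cycles *)

Lemma val_iter_ordS k (i : 'I_k) n : iter n (@ordS k) i = (i + n) %% k :> nat.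
Proof.
elim: n => [|n IH]; first by rewrite addn0 modn_small.
by rewrite /= IH -addn1 modnDml addn1 addnS.
Qed.

Lemma iter_ordS_neq k (i : 'I_k) n : 0 < n < k -> iter n (@ordS k) i != i.
Proof.
move=> n_bounds; apply/eqP => /(congr1 val) /=; rewrite val_iter_ordS.
have ik := ltn_ord i; have [lt_k|ge_k] := ltnP (i + n) k.
  by rewrite modn_small //; lia.
by rewrite -(subnK ge_k) modnDr modn_small; lia.
Qed.

Definition cyclic_pattern (V : finType) k (E : 'I_k -> {set V}) :=
  (forall i, #|E i :&: E (ordS i)| = 1) /\
  (forall i j, i != j -> j != ordS i -> i != ordS j -> E i :&: E j = set0).

Definition pattern_free (V : finType) k (M : {set {set V}}) :=
  forall E : 'I_k -> {set V}, (forall i, E i \in M) -> ~ cyclic_pattern E.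

Section Blocks.
Variables (T : finType) (k : nat) (e : 'I_k -> {set T}).
Hypothesis k_ge4 : 4 <= k.
Hypothesis pattern : cyclic_pattern e.

(* The edges of a linear cycle, each without its intersection with the
   preceding edge, partition the vertices; [block_seq i] lists the [i]-th block
   starting with the vertex shared with the next edge. *)
Definition block i := e i :\: e (ord_pred i).

Definition block_seq i :=
  enum (e i :&: e (ordS i)) ++ enum (block i :\: e (ordS i)).

Lemma cyclic_pattern_skip i : e i :&: e (ordS (ordS i)) = set0.
Proof.
apply: (proj2 pattern).
- by rewrite eq_sym; apply: (@iter_ordS_neq _ i 2); lia.
- by apply: (@iter_ordS_neq _ (ordS i) 1); lia.
- by rewrite eq_sym; apply: (@iter_ordS_neq _ i 3); lia.
Qed.

Lemma mem_block_seq i x : (x \in block_seq i) = (x \in block i).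
Proof.
rewrite mem_cat !mem_enum !inE.
have /setP/(_ x) := cyclic_pattern_skip (ord_pred i); rewrite !inE ord_predK.
by case: (x \in e i); case: (x \in e (ordS i)); case: (x \in e (ord_pred i)).
Qed.

Lemma block_seq_uniq i : uniq (block_seq i).
Proof.
rewrite cat_uniq !enum_uniq andbT; apply/hasPn => x.
by rewrite !mem_enum !inE => /andP[/negbTE ->]; rewrite andbF.
Qed.

Lemma size_block_seq i : size (block_seq i) = #|e i|.-1.
Proof.
have := proj1 pattern (ord_pred i); rewrite ord_predK setIC => shared.
rewrite -(cardsID (e (ord_pred i)) (e i)) shared /= -/(block i).
rewrite -(card_uniqP (block_seq_uniq i)).
by apply: eq_card => x; rewrite mem_block_seq.
Qed.

Lemma block_inj i j x : x \in block i -> x \in block j -> i = j.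
Proof.
rewrite !inE => /andP[xNi xi] /andP[xNj xj].
have [//|ij] := eqVneq i j.
have [ji|j_neq] := eqVneq j (ordS i); first by rewrite ji ordSK xi in xNj.
have [ij'|i_neq] := eqVneq i (ordS j); first by rewrite ij' ordSK xj in xNi.
by have /setP/(_ x) := proj2 pattern i j ij j_neq i_neq; rewrite !inE xi xj.
Qed.

Lemma block_cover i x : x \in e i -> exists j, x \in block j.
Proof.
move=> xi; have [xp|xp] := boolP (x \in e (ord_pred i)); last first.
  by exists i; rewrite inE xp.
exists (ord_pred i); rewrite inE xp andbT; apply/negP => xpp.
have /setP/(_ x) := cyclic_pattern_skip (ord_pred (ord_pred i)).
by rewrite !inE !ord_predK xi xpp.
Qed.

Lemma shared_mem_block i x : x \in e i -> x \in e (ordS i) -> x \in block i.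
Proof. by move=> xi xs; rewrite -mem_block_seq mem_cat mem_enum inE xi xs. Qed.

Lemma index_shared i x :
  x \in e i -> x \in e (ordS i) -> index x (block_seq i) = 0.
Proof.
move=> xi xs; have /eqP/cards1P[y shared] := proj1 pattern i.
have : x \in e i :&: e (ordS i) by rewrite inE xi.
by rewrite /block_seq shared enum_set1 inE => /eqP -> /=; rewrite eqxx.
Qed.

Lemma nth0_block_seq x0 i : nth x0 (block_seq i) 0 \in e i :&: e (ordS i).
Proof.
rewrite /block_seq; have /eqP/cards1P[y ->] := proj1 pattern i.
by rewrite enum_set1 /= inE.
Qed.
End Blocks.

Section LinearCycleIsomorphism.
Variables (T V : finType) (k r : nat).
Variables (e : 'I_k -> {set T}) (E : 'I_k -> {set V}) (i0 : 'I_k) (x0 : V).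
Hypothesis k_ge4 : 4 <= k.
Hypotheses (e_pattern : cyclic_pattern e) (E_pattern : cyclic_pattern E).
Hypotheses (e_card : forall i, #|e i| = r) (E_card : forall i, #|E i| = r).
Hypothesis e_cover : forall v, exists i, v \in e i.

Definition block_of v := odflt i0 [pick i | v \in block e i].

Definition block_map v :=
  nth x0 (block_seq E (block_of v)) (index v (block_seq e (block_of v))).

Lemma mem_block_of v : v \in block e (block_of v).
Proof.
rewrite /block_of; case: pickP => //= no_block.
by have [i /(block_cover k_ge4 e_pattern)[j]] := e_cover v; rewrite no_block.
Qed.

Lemma block_of_eq v i : v \in block e i -> block_of v = i.
Proof. exact: (block_inj e_pattern (mem_block_of v)). Qed.

Lemma index_block_of_lt v :
  index v (block_seq e (block_of v)) < size (block_seq E (block_of v)).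
Proof.
rewrite size_block_seq // E_card -(e_card (block_of v)) -size_block_seq //.
by rewrite index_mem mem_block_seq // mem_block_of.
Qed.

Lemma block_map_mem v : block_map v \in block E (block_of v).
Proof. by rewrite -mem_block_seq // mem_nth // index_block_of_lt. Qed.

Lemma block_map_inj : injective block_map.
Proof.
move=> v w vw; have bvw : block_of v = block_of w.
  by apply: (block_inj E_pattern (block_map_mem v)); rewrite vw block_map_mem.
have := index_block_of_lt v; rewrite bvw => v_lt.
move/eqP: vw; rewrite /block_map bvw.
rewrite nth_uniq ?block_seq_uniq ?index_block_of_lt //.
have v_mem : v \in block_seq e (block_of w).
  by rewrite mem_block_seq // -bvw mem_block_of.
have w_mem : w \in block_seq e (block_of w).
  by rewrite mem_block_seq // mem_block_of.
by move=> /eqP index_eq; rewrite -(nth_index v v_mem) index_eq nth_index.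
Qed.

Lemma block_map_edge i : block_map @: e i = E i.
Proof.
apply/eqP; rewrite eqEcard (card_imset _ block_map_inj).
rewrite e_card E_card leqnn andbT.
apply/subsetP => x /imsetP[v vi ->].
have [vp|vp] := boolP (v \in e (ord_pred i)); last first.
  have /block_of_eq b : v \in block e i by rewrite inE vp.
  by have := block_map_mem v; rewrite b inE => /andP[].
have vs : v \in e (ordS (ord_pred i)) by rewrite ord_predK.
have /block_of_eq b := shared_mem_block k_ge4 e_pattern vp vs.
have := nth0_block_seq E_pattern x0 (ord_pred i); rewrite ord_predK inE.
by rewrite /block_map b index_shared // => /andP[].
Qed.
End LinearCycleIsomorphism.

Lemma pattern_free_of_no_copy k r (C H : uhypergraph r) :
  4 <= k -> is_linear_cycle k C -> ~ contains_copy (edges H) C ->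
  pattern_free k (edges H).
Proof.
move=> k_ge4 [e [C_edges e_cover e_shared e_disj]] no_copy E EH E_pattern.
have i0 : 'I_k by apply: (@Ordinal _ 0); lia.
have [x0 _] : exists x, x \in E i0 :&: E (ordS i0).
  by apply/card_gt0P; rewrite (proj1 E_pattern).
have e_pattern : cyclic_pattern e by [].
have e_card i : #|e i| = r.
  by apply: (@edges_uniform _ C); rewrite C_edges imset_f.
have E_card i := edges_uniform (EH i).
apply: no_copy; exists (block_map e E i0 x0).
  exact: block_map_inj e_pattern E_pattern e_card E_card e_cover.
move=> X; rewrite C_edges => /imsetP[i _ ->].
by rewrite (block_map_edge _ _ _ e_pattern E_pattern e_card).
Qed.

(** * Periodic patterns *)

Lemma rot_modn (T : Type) (x0 : T) p n : rot (n %% size p) p =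
  [seq nth x0 p (j %% size p) | j <- iota n (size p)].
Proof.
case: (posnP (size p)) => [/size0nil->|p_gt0]; first by [].
apply: (@eq_from_nth _ x0); rewrite size_rot ?size_map ?size_iota // => i i_lt.
rewrite (nth_map 0) ?size_iota // nth_iota // -modnDml.
have n_lt := ltn_pmod n p_gt0; move: (n %% _) n_lt => {}n n_lt.
rewrite /rot nth_cat size_drop nth_drop; case: ltnP => le_i.
  by rewrite modn_small //; lia.
have -> : n + i = (i - (size p - n)) + size p by lia.
by rewrite modnDr modn_small ?nth_take //; lia.
Qed.

Lemma cycle_nth_modn (T : Type) (F : rel T) (x0 : T) p j :
  1 < size p -> cycle F p ->
  F (nth x0 p (j %% size p)) (nth x0 p (j.+1 %% size p)).
Proof.
move=> p_gt1; rewrite -(rot_cycle (j %% size p)) (rot_modn x0).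
by case: (size p) p_gt1 => [|[|k]] //= _ /andP[].
Qed.

Lemma last_iota n l : last n (iota n.+1 l) = n + l.
Proof. by elim: l n => [|l IH] n /=; rewrite ?addn0 // IH addSnnS. Qed.

Section PeriodicPattern.
Variables (V : finType) (m : nat) (X : nat -> V) (A : nat -> {set V}).
Local Notation k := (2 * m).
Hypothesis m_gt1 : 1 < m.
Hypothesis X_periodic : forall j, X (j + k) = X j.
Hypothesis A_periodic : forall j, A (j + k) = A j.
Hypothesis X_neqS : forall j, X j != X j.+1.
Hypotheses (mem_A : forall j, X j \in A j) (memS_A : forall j, X j.+1 \in A j).
Hypothesis meet_A : forall n j, n <= j < n + m ->
  A j :&: A (n + m) \subset [set X (n + m)].

Lemma periodic_meet a b w : a < b <= a + m -> w \in A a -> w \in A b -> w = X b.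
Proof.
move=> ab wa wb; rewrite -X_periodic; apply/set1P.
have -> : b + k = (b + m) + m by lia.
apply: (subsetP (meet_A (_ : b + m <= a + k < _))); first by lia.
by rewrite inE A_periodic wa (_ : b + m + m = b + k) ?A_periodic //; lia.
Qed.

Lemma periodic_disjoint a b : a.+1 < b <= a + m -> A a :&: A b = set0.
Proof.
case: b => // b ab; apply/setP => w; rewrite !inE; apply/negP => /andP[wa wb].
have w_eq : w = X b.+1 by apply: (periodic_meet _ wa wb); lia.
have w_eq' : w = X b by apply: (periodic_meet _ wa); [lia | rewrite w_eq].
by have := X_neqS b; rewrite -w_eq -w_eq' eqxx.
Qed.

Lemma periodic_cyclic_pattern : cyclic_pattern (fun i : 'I_k => A i).
Proof.
split=> [i|i j].
  have -> : A (ordS i) = A i.+1.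
    have [lt_k|ge_k] := ltnP i.+1 k; first by rewrite /= modn_small.
    have ik : i.+1 = k by apply/eqP; rewrite eqn_leq ge_k ltn_ord.
    by rewrite /= ik modnn -(A_periodic 0).
  apply/eqP/cards1P; exists (X i.+1); apply/setP => w; rewrite !inE.
  apply/andP/eqP => [[wi wS]|->]; last by rewrite memS_A mem_A.
  by apply: (periodic_meet _ wi wS); lia.
wlog ij : i j / i < j => [W ne ji ij'|ne ji ij'].
  have [lt_ij|lt_ji|eq_ij] := ltngtP i j; first exact: W.
    by rewrite setIC W // eq_sym.
  by case/eqP: ne; apply: val_inj.
have i1j : i.+1 < j.
  rewrite ltn_neqAle ij andbT; apply: contraNneq ji => i1j.
  by apply/eqP/val_inj; rewrite /= i1j modn_small.
have [j_le|j_gt] := leqP j (i + m).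
  by apply: periodic_disjoint; rewrite i1j.
rewrite setIC -(A_periodic i); apply: periodic_disjoint.
suff : i + k != j.+1 by have := ltn_ord j; lia.
apply: contraNneq ij' => ik; have jk := ltn_ord j.
have [i_eq0 jS] : i = 0 :> nat /\ j.+1 = k by lia.
by apply/eqP/val_inj; rewrite /= jS modnn.
Qed.
End PeriodicPattern.

(** * Kernels of a uniform hypergraph *)

Definition codegree (V : finType) (M : {set {set V}}) (B : {set V}) :=
  #|[set A in M | B \subset A]|.

Section Kernels.
Variables (r q : nat) (H : uhypergraph r).
Implicit Types (A B Z e : {set vertex H}).

(* As in the delta-system method, a robust set behaves like an edge: it can
   be completed to an edge avoiding any [q] other vertices. *)
Definition robust A :=
  [forall Z : {set vertex H}, (#|Z| <= q) && [disjoint A & Z] ==>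
    [exists e in edges H, (A \subset e) && [disjoint e & Z]]].

Definition kernels := [set A |
  minset [pred B : {set vertex H} | (1 < #|B|) && robust B] A].

Lemma robustP A : reflect
  (forall Z, #|Z| <= q -> [disjoint A & Z] ->
    exists e, [/\ e \in edges H, A \subset e & [disjoint e & Z]])
  (robust A).
Proof.
apply: (iffP forallP) => A_robust Z => [Zq AZ|]; last first.
  apply/implyP => /andP[Zq AZ]; have [e [eH Ae eZ]] := A_robust Z Zq AZ.
  by apply/existsP; exists e; rewrite eH Ae.
have := A_robust Z; rewrite Zq AZ => /existsP[e /and3P[eH Ae eZ]].
by exists e.
Qed.

Lemma robustPn B : reflect
  (exists Z, [/\ #|Z| <= q, [disjoint B & Z]
    & forall A, robust A -> B \subset A -> ~~ [disjoint A & Z]])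
  (~~ robust B).
Proof.
apply: (iffP idP) => [|[Z [Zq BZ Z_hits]]]; last first.
  by apply/negP => B_robust; have := Z_hits B B_robust (subxx B); rewrite BZ.
rewrite negb_forall => /existsP[Z]; rewrite negb_imply.
move=> /andP[/andP[Zq BZ] /existsP Z_hits]; exists Z; split=> // A.
move=> /robustP/(_ Z Zq) A_ext BA; apply/negP => /A_ext[e [eH Ae eZ]].
by case: Z_hits; exists e; rewrite eH (subset_trans BA Ae).
Qed.

Lemma kernel_robust A : A \in kernels -> robust A.
Proof. by rewrite inE => /minsetp/andP[]. Qed.

Lemma card_kernel_gt1 A : A \in kernels -> 1 < #|A|.
Proof. by rewrite inE => /minsetp/andP[]. Qed.

Lemma kernel_min A B :
  A \in kernels -> B \subset A -> 1 < #|B| -> robust B -> B = A.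
Proof.
rewrite inE => /minsetP[_ A_min] BA B_gt1 B_robust; apply: A_min => //=.
by rewrite B_gt1.
Qed.

Lemma card_robust A : robust A -> #|A| <= r.
Proof.
move/robustP/(_ set0); rewrite cards0 disjoints_subset setC0 subsetT.
by case=> // e [/edges_uniform e_card /subset_leq_card]; rewrite e_card.
Qed.

Lemma card_kernel A : A \in kernels -> #|A| <= r.
Proof. by move/kernel_robust/card_robust. Qed.

Lemma edge_contains_kernel e : 1 < r -> e \in edges H ->
  exists2 A, A \in kernels & A \subset e.
Proof.
move=> r_gt1 eH.
have e_robust : [pred B : {set vertex H} | (1 < #|B|) && robust B] e.
  by rewrite /= (edges_uniform eH) r_gt1; apply/robustP => Z _ eZ; exists e.
by have [A A_min Ae] := minset_exists e_robust; exists A; rewrite ?inE.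
Qed.

Lemma codegree_kernels_robust B : 1 < #|B| -> robust B ->
  codegree kernels B <= 1.
Proof.
move=> B_gt1 B_robust; rewrite -(cards1 B); apply/subset_leq_card/subsetP => A.
by rewrite inE in_set1 => /andP[AK BA]; rewrite (kernel_min AK BA).
Qed.

(* All kernels above a set that is not robust meet a fixed set of at most [q]
   other vertices. *)
Lemma codegree_kernels j B : 1 < #|B| -> r <= #|B| + j ->
  codegree kernels B <= q.+1 ^ j.
Proof.
elim: j B => [|j IH] B B_gt1 Bj.
  rewrite addn0 in Bj; rewrite expn0 -(cards1 B).
  apply/subset_leq_card/subsetP => A.
  rewrite inE in_set1 eq_sym eqEcard => /andP[AK ->].
  exact: leq_trans (card_kernel AK) Bj.
have [B_robust|/robustPn[Z [Zq BZ Z_hits]]] := boolP (robust B).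
  by rewrite (leq_trans (codegree_kernels_robust B_gt1 B_robust)) ?expn_gt0.
apply: leq_trans (_ : \sum_(z in Z) codegree kernels (z |: B) <= _).
  apply: leq_trans (leq_card_bigcup _ _); apply/subset_leq_card/subsetP => A.
  rewrite inE => /andP[AK BA]; have := Z_hits A (kernel_robust AK) BA.
  rewrite -setI_eq0 => /set0Pn[z]; rewrite inE => /andP[zA zZ].
  by apply/bigcupP; exists z => //; rewrite inE AK subUset sub1set zA.
apply: leq_trans (_ : \sum_(z in Z) q.+1 ^ j <= _).
  apply: leq_sum => z zZ; have zB : z \notin B by rewrite (disjointFl BZ).
  by apply: IH; rewrite cardsU1 zB; lia.
by rewrite sum_nat_const expnS leq_mul // leqW.
Qed.

Section Extension.
Variables (k : nat) (A : 'I_k -> {set vertex H}).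
Hypotheses (kr_le_q : k * r <= q) (A_robust : forall i, robust (A i)).

(* The intermediate stages of replacing the [A i] one by one by edges. *)
Lemma extend_robust_upto j : j <= k -> exists E : 'I_k -> {set vertex H},
  [/\ forall i : 'I_k, i < j -> E i \in edges H,
      forall i : 'I_k, j <= i -> E i = A i, forall i, #|E i| <= r
    & forall i i', i != i' -> E i :&: E i' = A i :&: A i'].
Proof.
elim: j => [|j IH] jk; first by exists A; split=> // i; apply: card_robust.
have [E [EH EA E_card EI]] := IH (ltnW jk); pose i0 := Ordinal jk.
pose Z := (\bigcup_i E i) :\: A i0.
have Zq : #|Z| <= q.
  apply: leq_trans kr_le_q; apply: leq_trans (subset_leq_card (subsetDl _ _)) _.
  apply: leq_trans (leq_card_bigcup _ _) _; rewrite -[k in k * r]card_ord.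
  by rewrite -sum_nat_const; apply: leq_sum.
have AZ : [disjoint A i0 & Z].
  by rewrite disjoint_sym disjoints_subset subDset setUCr.
have /robustP/(_ Z Zq AZ)[e [eH Ae eZ]] := A_robust i0.
have eE i : i != i0 -> e :&: E i = A i0 :&: A i.
  move=> ii0; rewrite -(EI i0 i) 1?eq_sym // (EA i0) //.
  apply/eqP; rewrite eqEsubset (setSI _ Ae) andbT subsetI subsetIr andbT.
  apply/subsetP => x /setIP[xe xE]; apply: contraLR (xe) => xA.
  by rewrite (disjointFl eZ) // inE xA; apply/bigcupP; exists i.
exists (fun i => if i == i0 then e else E i); split=> [i|i|i|i i'].
- rewrite ltnS leq_eqVlt; case: (eqVneq i i0) => // ii0 /predU1P[ij|].
    by case/eqP: ii0; apply: val_inj.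
  exact: EH.
- by case: (eqVneq i i0) => [->|_ /ltnW/EA//]; rewrite ltnn.
- by case: eqVneq => // _; rewrite (edges_uniform eH).
case: (eqVneq i i0) => [->|ii0]; case: (eqVneq i' i0) => [->|i'i0] //.
- by rewrite eE.
- by rewrite setIC eE // setIC.
- exact: EI.
Qed.

Lemma extend_robust_pattern : 1 < k -> cyclic_pattern A ->
  exists2 E : 'I_k -> {set vertex H},
    forall i, E i \in edges H & cyclic_pattern E.
Proof.
move=> k_gt1 [A_shared A_disj].
have [E [EH _ _ EI]] := extend_robust_upto (leqnn k).
exists E => [i|]; first exact: EH.
split=> [i|i j ij ji ij']; last by rewrite EI // A_disj.
by rewrite EI // eq_sym (@iter_ordS_neq _ i 1).
Qed.
End Extension.

Lemma kernels_pattern_free k : 1 < k -> k * r <= q ->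
  pattern_free k (edges H) -> pattern_free k kernels.
Proof.
move=> k_gt1 kr_le_q H_free A AK A_pattern.
have [|E EH] := extend_robust_pattern kr_le_q _ k_gt1 A_pattern.
  by move=> i; apply: kernel_robust.
exact: H_free.
Qed.
End Kernels.

(** * The shadow of a set family *)

Section Shadow.
Variables (V : finType) (M : {set {set V}}).
Implicit Types (A U : {set V}) (x y z w : V) (p : seq V).

Definition shadow x y := (x != y) && [exists A in M, [set x; y] \subset A].

Definition covering_set x y : {set V} :=
  odflt set0 [pick A in M | [set x; y] \subset A].

Fixpoint walk_cover x p : {set V} :=
  if p is y :: p' then covering_set x y :|: walk_cover y p' else set0.

(* A closed walk of length [2 * m] that never steps to a crossing neighbour of
   its [m] previous steps has a cyclic pattern of covering sets. *)
Definition crossing_nbrs x p := [set z | shadow (last x p) z &&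
  ~~ (walk_cover x p :&: covering_set (last x p) z \subset [set last x p])].

Lemma shadow_sym : symmetric shadow.
Proof. by move=> x y; rewrite /shadow eq_sym setUC. Qed.

Lemma covering_setP x y : shadow x y ->
  [/\ covering_set x y \in M, x \in covering_set x y & y \in covering_set x y].
Proof.
rewrite /shadow /covering_set => /andP[_ /existsP[A A_cover]].
case: pickP => [B /andP[BM]|/(_ A)]; last by rewrite A_cover.
by rewrite subUset !sub1set => /andP[].
Qed.

Lemma mem_walk_cover (X : nat -> V) w a j l : a <= j < a + l ->
  w \in covering_set (X j) (X j.+1) ->
  w \in walk_cover (X a) [seq X i | i <- iota a.+1 l].
Proof.
elim: l a => [|l IH] a ajl wj; first by lia.
rewrite /= inE; have [->|aj] := eqVneq a j; first by rewrite wj.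
by apply/orP; right; apply: IH => //; lia.
Qed.

Section SparseShadow.
Variables (r c m : nat).
Hypothesis M_card : {in M, forall A, #|A| <= r}.
Hypothesis M_codeg : forall x y, x != y -> codegree M [set x; y] <= c.

Lemma card_walk_cover x p : path shadow x p -> #|walk_cover x p| <= size p * r.
Proof.
elim: p x => [|y p IH] x /=; first by rewrite cards0.
case/andP => /covering_setP[/M_card A_card _ _] /IH p_card; rewrite mulSn.
exact: leq_trans (leq_card_setU _ _) (leq_add A_card p_card).
Qed.

Lemma card_crossing_nbrs x p :
  path shadow x p -> #|crossing_nbrs x p| <= size p * r * (c * r).
Proof.
move=> p_path; set y := last x p.
pose above w := [set A in M | [set y; w] \subset A].
pose reach w := if w == y then set0 else cover (above w).
apply: leq_trans (_ : \sum_(w in walk_cover x p) (c * r) <= _); last first.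
  by rewrite sum_nat_const leq_mul // card_walk_cover.
apply: leq_trans (_ : #|\bigcup_(w in walk_cover x p) reach w| <= _).
  apply/subset_leq_card/subsetP => z; rewrite inE.
  case/andP=> /covering_setP[AM yA zA] /subsetPn[w /setIP[wp wA]].
  rewrite inE => wy; apply/bigcupP; exists w; rewrite // /reach (negbTE wy).
  apply/bigcupP; exists (covering_set y z) => //.
  by rewrite inE AM subUset !sub1set yA.
apply: leq_trans (leq_card_bigcup _ _) _; apply: leq_sum => w _.
rewrite /reach; case: eqVneq => [_|wy]; first by rewrite cards0.
apply: leq_trans (leq_card_cover _) _.
apply: leq_trans (_ : \sum_(A in above w) r <= _).
  by apply: leq_sum => A; rewrite inE => /andP[/M_card].
by rewrite sum_nat_const leq_mul //; apply: M_codeg; rewrite eq_sym.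
Qed.

Lemma card_members_le U : {in M, forall A, 1 < #|A|} ->
  #|M ::&: U| <= c * deg_sum shadow U.
Proof.
move=> M_gt1; rewrite /deg_sum big_distrr /=.
apply: leq_trans (_ : #|\bigcup_(x in U) \bigcup_(y in nbrs shadow U x)
   [set A in M | [set x; y] \subset A]| <= _).
  apply/subset_leq_card/subsetP => A; rewrite inE => /andP[AM /subsetP AU].
  have /card_gt1P[x [y [xA yA xy]]] := M_gt1 A AM.
  have xyA : [set x; y] \subset A by rewrite subUset !sub1set xA.
  apply/bigcupP; exists x; first exact: AU.
  apply/bigcupP; exists y; last by rewrite inE AM.
  by rewrite inE AU // /shadow xy; apply/existsP; exists A; rewrite AM.
apply: leq_trans (leq_card_bigcup _ _) _; apply: leq_sum => x _.
apply: leq_trans (leq_card_bigcup _ _) _; rewrite mulnC -sum_nat_const.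
by apply: leq_sum => y; rewrite inE => /andP[_ /andP[xy _]]; apply: M_codeg.
Qed.

Hypothesis m_gt1 : 1 < m.
Hypothesis M_free : pattern_free (2 * m) M.

Section ClosedWalk.
Variables (x0 : V) (p : seq V).
Hypotheses (p_size : size p = 2 * m) (p_cycle : cycle shadow p).
Let X j := nth x0 p (j %% size p).

Lemma closed_walk_step j : shadow (X j) (X j.+1).
Proof. by apply: cycle_nth_modn p_cycle; rewrite p_size; lia. Qed.

Lemma nondegenerate_meet n j :
  (forall i, i < 2 * m -> ~~ degenerate m crossing_nbrs (rot i p)) ->
  n <= j < n + m ->
  covering_set (X j) (X j.+1) :&: covering_set (X (n + m)) (X (n + m).+1)
    \subset [set X (n + m)].
Proof.
move=> p_nondeg nj.
have : ~~ degenerate m crossing_nbrs (rot (n.+1 %% size p) p).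
  by rewrite p_nondeg // -p_size ltn_pmod; lia.
have Xn : X (n.+1 + m + m.-1) = X n.
  by rewrite /X (_ : n.+1 + m + m.-1 = n + size p) ?modnDr //; lia.
rewrite (rot_modn x0 p n.+1 : _ = [seq X j | j <- _]) /degenerate.
rewrite -map_drop -map_take take_iota drop_iota.
have [-> ->] : minn m (size p) = m /\ size p - m = m.-1.+1 by lia.
rewrite /= last_map last_iota inE Xn addSn.
rewrite last_map last_iota closed_walk_step negbK; apply: subset_trans.
by rewrite setSI //; apply/subsetP => w; apply: mem_walk_cover.
Qed.

Lemma exists_degenerate_rot :
  exists2 i, i < 2 * m & degenerate m crossing_nbrs (rot i p).
Proof.
have [/existsP[i i_deg]|] :=
  boolP [exists i : 'I_(2 * m), degenerate m crossing_nbrs (rot i p)].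
  by exists i.
rewrite negb_exists => /forallP p_nondeg.
pose A j := covering_set (X j) (X j.+1).
have A_P j := covering_setP (closed_walk_step j).
case: (@M_free (fun i => A i)) => [i|]; first by have [] := A_P i.
have X_periodic j : X (j + 2 * m) = X j by rewrite /X -p_size modnDr.
apply: (periodic_cyclic_pattern m_gt1 X_periodic) => [j|j|j|j|n j].
- by rewrite /A -addSn !X_periodic.
- by case/andP: (closed_walk_step j).
- by case: (A_P j).
- by case: (A_P j).
- by apply: nondegenerate_meet => i i_lt; apply: (p_nondeg (Ordinal i_lt)).
Qed.
End ClosedWalk.

Definition shadow_const := (2 * m) ^ 2 * (m * r * (c * r)).

Lemma shadow_const_gt0 : 0 < r -> 0 < c -> 0 < shadow_const.
Proof. by move=> r_gt0 c_gt0; rewrite !muln_gt0 r_gt0 c_gt0 (ltnW m_gt1). Qed.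

Lemma sqr_deg_sum_shadow_le U d theta : 0 < r -> 0 < c -> #|V| <= theta ^ m ->
  bounded_deg shadow U d ->
  deg_sum shadow U ^ 2 <= shadow_const * d * theta * #|V| ^ 2.
Proof.
move=> r_gt0 c_gt0 V_le U_deg.
pose F x y := [&& shadow x y, x \in U & y \in U].
have F_sym : symmetric F.
  by move=> x y; rewrite /F shadow_sym [(x \in U) && _]andbC.
have F_shadow : subrel F shadow by move=> x y /and3P[].
have F_deg x : #|F x| = if x \in U then #|nbrs shadow U x| else 0.
  case: ifP => xU; last by apply: eq_card0 => y; rewrite unfold_in /F xU andbF.
  by apply: eq_card => y; rewrite inE unfold_in /F xU andbC.
have -> : deg_sum shadow U = \sum_x #|F x|.
  by rewrite /deg_sum big_mkcond; apply: eq_bigr => x _; rewrite F_deg.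
apply: (@sqr_sum_deg_le_of_degenerate _ _ _ _ _ crossing_nbrs) => //.
- exact: ltnW.
- by rewrite !muln_gt0 r_gt0 c_gt0 (ltnW m_gt1).
- by move=> x; rewrite F_deg; case: ifP => // /U_deg.
- by move=> x p <- /(sub_path F_shadow)/card_crossing_nbrs.
case=> [|x0 p] p_size p_cycle; first by move: p_size => /=; lia.
by apply: (exists_degenerate_rot x0 p_size); apply: sub_path p_cycle.
Qed.
End SparseShadow.
End Shadow.

(** * The graph of two-element members *)

Lemma card_triangles_le (V : finType) (G : rel V) (U : {set V}) : symmetric G ->
  #|triangles G ::&: U| <= \sum_(x in U) deg_sum G (nbrs G U x).
Proof.
move=> G_sym; apply: leq_trans (_ : #|\bigcup_(x in U) \bigcup_(y in nbrs G U x)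
   \bigcup_(z in nbrs G (nbrs G U x) y) [set [set x; y; z]]| <= _); last first.
  apply: leq_trans (leq_card_bigcup _ _) _; apply: leq_sum => x _.
  apply: leq_trans (leq_card_bigcup _ _) _; apply: leq_sum => y _.
  apply: leq_trans (leq_card_bigcup _ _) _.
  by under eq_bigr do rewrite cards1; rewrite sum1_card.
apply/subset_leq_card/subsetP => B; rewrite !inE.
move=> /andP[/andP[/eqP B3 B_adj] /subsetP BU].
have /card_gt2P[x [y [z [[xB yB zB] [xy yz zx]]]]] : 2 < #|B| by rewrite B3.
have adj a b : a \in B -> b \in B -> a != b -> G a b.
  by move=> aB bB; apply/implyP; apply: (forall_inP (forall_inP B_adj a aB)).
apply/bigcupP; exists x; first exact: BU.
apply/bigcupP; exists y; first by rewrite inE BU ?adj.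
apply/bigcupP; exists z; first by rewrite !inE BU ?adj // eq_sym.
rewrite inE eq_sym eqEcard !subUset !sub1set xB yB zB /= B3.
by rewrite -setUA cardsU1 !inE negb_or xy eq_sym zx cards2 yz.
Qed.

Section PairGraph.
Variables (V : finType) (M : {set {set V}}).
Implicit Types (A U : {set V}) (x y z : V) (p : seq V).

Definition pair_graph x y := (x != y) && ([set x; y] \in M).

Definition pair_members := [set A in M | #|A| == 2].

Definition large_members := [set A in M | 2 < #|A|].

Lemma pair_graph_sym : symmetric pair_graph.
Proof. by move=> x y; rewrite /pair_graph eq_sym setUC. Qed.

Lemma pair_graph_irr : irreflexive pair_graph.
Proof. by move=> x; rewrite /pair_graph eqxx. Qed.

Lemma pair_graph_sub_shadow : subrel pair_graph (shadow M).
Proof.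
move=> x y /andP[xy xyM]; rewrite /shadow xy; apply/existsP; exists [set x; y].
by rewrite xyM subxx.
Qed.

Lemma card_nbrs_pair_graph_le U x : x \in U ->
  #|nbrs pair_graph U x| <= #|[set A in pair_members ::&: U | x \in A]|.
Proof.
move=> xU; rewrite -(@card_in_imset _ _ (fun y => [set x; y])) => [|y z].
  apply/subset_leq_card/subsetP => A /imsetP[y].
  rewrite inE => /andP[yU /andP[xy xyM]] ->.
  by rewrite !inE xyM cards2 xy eqxx subUset !sub1set xU yU.
rewrite !inE => /andP[_ /andP[xy _]] _ /setP/(_ y).
by rewrite !inE eqxx orbT eq_sym (negbTE xy) => /esym/eqP.
Qed.

Lemma deg_sum_pair_graph_le U :
  deg_sum pair_graph U <= 2 * #|pair_members ::&: U|.
Proof.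
apply: leq_trans
  (_ : \sum_(x in U) #|[set A in pair_members ::&: U | x \in A]| <= _).
  by apply: leq_sum => x; apply: card_nbrs_pair_graph_le.
rewrite sum_card_exchange mulnC -sum_nat_const; apply: leq_sum => A.
rewrite !inE => /andP[/andP[_ /eqP A2] _]; rewrite -A2.
by apply/subset_leq_card/subsetP => x; rewrite inE => /andP[].
Qed.

Section PatternFree.
Variable k : nat.
Hypothesis k_gt2 : 2 < k.
Hypothesis M_free : pattern_free k M.

Lemma pair_graph_no_cycle p : size p = k -> uniq p -> ~~ cycle pair_graph p.
Proof.
move=> p_size p_uniq; apply/negP => p_cycle.
have [x0 _] : exists x0, x0 \in p.
  by case: (p) p_size => [/=|a s _]; [lia | exists a; rewrite mem_head].
pose X (i : 'I_k) := nth x0 p i.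
have X_inj : injective X.
  by move=> i j /eqP; rewrite nth_uniq ?p_size // => /eqP/val_inj.
have X_adj i : pair_graph (X i) (X (ordS i)).
  have := @cycle_nth_modn _ _ x0 p i _ p_cycle; rewrite p_size modn_small //.
  by apply; lia.
case: (@M_free (fun i => [set X i; X (ordS i)])) => [i|].
  by case/andP: (X_adj i).
have SS_neq (i : 'I_k) : ordS (ordS i) != i.
  by apply: (@iter_ordS_neq _ i 2); lia.
split=> [i|i j ij ji ij'].
  apply/eqP/cards1P; exists (X (ordS i)); apply/setP => x; rewrite !inE.
  have [->|xS] := eqVneq x (X (ordS i)); first by rewrite orbT.
  rewrite orbF; apply/andP => -[/eqP-> /eqP/X_inj/eqP].
  by rewrite eq_sym (negbTE (SS_neq i)).
apply/setP => x; rewrite !inE; apply/negP => /andP[].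
move=> /orP[] /eqP -> /orP[]; rewrite (inj_eq X_inj); apply/negP => //.
- by rewrite eq_sym.
- by rewrite (inj_eq (@ordS_inj k)).
Qed.

Lemma deg_sum_nbrs_pair_graph_le U x :
  deg_sum pair_graph (nbrs pair_graph U x) <= 2 * k * #|nbrs pair_graph U x|.
Proof.
apply: leq_trans (_ : 2 * k.-1 * #|nbrs pair_graph U x| <= _); last first.
  by rewrite !leq_mul // leq_pred.
apply: (deg_sum_le_of_no_path pair_graph_sym) => p p_size p_uniq p_path pN.
have adj y : y \in p -> pair_graph x y by move/pN; rewrite inE => /andP[].
have xp : x \notin p by apply/negP => /adj; rewrite pair_graph_irr.
have /negP[] : ~~ cycle pair_graph (x :: p).
  by apply: pair_graph_no_cycle; rewrite /= ?xp ?p_size //; lia.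
case: p p_size p_path adj {p_uniq pN xp} => [|a p] /= p_size p_path adj.
  by lia.
by rewrite adj ?mem_head //= rcons_path p_path pair_graph_sym adj ?mem_last.
Qed.
End PatternFree.
End PairGraph.

(** * Large sets containing no member of a pattern-free family *)

Section AvoidingSet.
Variables (V : finType) (M : {set {set V}}) (r c m : nat).
Hypothesis m_gt1 : 1 < m.
Hypotheses (r_gt0 : 0 < r) (c_gt0 : 0 < c).
Hypothesis M_card : {in M, forall A : {set V}, 1 < #|A| <= r}.
Hypothesis M_codeg : forall x y, x != y -> codegree M [set x; y] <= c.
Hypothesis M_free : pattern_free (2 * m) M.
Local Notation G := (pair_graph M).
Local Notation obstructions := (large_members M :|: triangles G).

Definition density_const := (c + 2 * (2 * m)) * (1024 * shadow_const r c m) * 2.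
Local Notation K := density_const.

Lemma density_const_gt0 : 0 < density_const.
Proof. by rewrite !muln_gt0 addn_gt0 c_gt0 r_gt0 (ltnW m_gt1). Qed.

Lemma card_members_triangles_le (U : {set V}) :
  #|M ::&: U| + #|triangles G ::&: U| <=
  (c + 2 * (2 * m)) * deg_sum (shadow M) U.
Proof.
rewrite mulnDl leq_add //.
  by apply: card_members_le => // A /M_card/andP[].
apply: leq_trans (card_triangles_le _ (@pair_graph_sym _ M)) _.
rewrite /deg_sum big_distrr; apply: leq_sum => x _ /=.
apply: leq_trans (deg_sum_nbrs_pair_graph_le _ M_free _ _) _; first by lia.
rewrite leq_mul //; apply/subset_leq_card/subsetP => y; rewrite !inE.
by case/andP => -> /pair_graph_sub_shadow.
Qed.

Lemma exists_few_members z : 0 < z -> #|V| <= z ^ (2 * m) ->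
  exists2 U : {set V}, #|V| <= 2 * #|U| &
    #|M ::&: U| + #|triangles G ::&: U| <= K * z ^ 2 * #|U|.
Proof.
move=> z_gt0 V_le; have V_le' : #|V| <= (z ^ 2) ^ m by rewrite -expnM.
have z2_gt0 : 0 < z ^ 2 by rewrite expn_gt0 z_gt0.
have M_le : {in M, forall A : {set V}, #|A| <= r} by move=> A /M_card/andP[].
have shadow_le U d : bounded_deg (shadow M) U d ->
    deg_sum (shadow M) U ^ 2 <= shadow_const r c m * d * z ^ 2 * #|V| ^ 2.
  exact: sqr_deg_sum_shadow_le.
have [U U_large U_sparse] :=
  exists_sparse_subset (shadow_const_gt0 m_gt1 r_gt0 c_gt0) z2_gt0 shadow_le.
have VU : #|V| <= 2 * #|U| by have := cardsC U; lia.
exists U => //; apply: leq_trans (card_members_triangles_le U) _.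
apply: leq_trans (leq_mul (leqnn _) U_sparse) _.
apply: leq_trans (leq_mul (leqnn _) (leq_mul (leqnn _) VU)) _.
by rewrite eq_leq // /density_const; ring.
Qed.

Lemma exists_few_obstructions z : 0 < z -> #|V| <= z ^ (2 * m) ->
  exists S : {set V}, [/\ #|V| <= 32 * K * z * #|S|,
    #|pair_members M ::&: S| <= 4 * z * #|S|
    & 2 * #|obstructions ::&: S| <= #|S|].
Proof.
move=> z_gt0 V_le; have [U VU U_few] := exists_few_members z_gt0 V_le.
have K_gt0 := density_const_gt0.
have q_gt0 : 0 < 8 * K * z by rewrite muln_gt0 z_gt0 andbT muln_gt0 K_gt0.
have [||||S _ [US S_pairs S_obs]] :=
  @exists_sample V U (pair_members M) obstructions _ z q_gt0 z_gt0.
- by move=> A; rewrite inE => /andP[_ /eqP->].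
- by move=> A; rewrite !inE => /orP[/andP[_]//|/andP[/eqP->]].
- apply: leq_trans (_ : K * z ^ 2 * #|U| <= _).
    apply: leq_trans U_few; apply: leq_trans (leq_addr _ _).
    apply/subset_leq_card/subsetP => A; rewrite !inE.
    by case/andP => /andP[->].
  by rewrite leq_mul // -mulnn -!mulnA leq_pmull.
- apply: leq_trans (_ : 8 * (K * z ^ 2 * #|U|) <= _); last first.
    have -> : (8 * K * z) ^ 2 * #|U| = 8 * (K * z ^ 2 * #|U|) * (8 * K) by ring.
    by rewrite leq_pmulr // muln_gt0 K_gt0.
  rewrite leq_mul //; apply: leq_trans U_few.
  apply: leq_trans (leq_card_setU _ _); apply/subset_leq_card/subsetP => A.
  by rewrite !inE => /andP[/orP[/andP[-> _]|->] ->]; rewrite ?orbT.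
exists S; split=> //; apply: leq_trans VU _.
apply: leq_trans (leq_mul (leqnn 2) US) _.
by rewrite eq_leq //; ring.
Qed.

Lemma exists_sparse_unobstructed z : 0 < z -> #|V| <= z ^ (2 * m) ->
  exists X : {set V}, [/\ #|V| <= 128 * K * z * #|X|,
    bounded_deg G X (32 * z) & avoids obstructions X].
Proof.
move=> z_gt0 V_le.
have [S [VS S_pairs S_obs]] := exists_few_obstructions z_gt0 V_le.
have no_set0 : set0 \notin obstructions ::&: S.
  by rewrite !inE cards0 andbF.
have [W [WS SW W_obs]] := exists_large_subset_avoiding no_set0 S_obs.
have [X [XW X_deg WX_le]] := exists_low_deg_subset G W (32 * z).
have W_deg : deg_sum G W <= 16 * z * #|W|.
  apply: leq_trans (deg_sum_pair_graph_le _ _) _.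
  apply: leq_trans (_ : 2 * (4 * z * #|S|) <= _); last by nia.
  rewrite leq_mul //; apply: leq_trans S_pairs.
  apply/subset_leq_card/subsetP => A.
  by rewrite !inE => /andP[-> AW]; apply: subset_trans WS.
have WX : #|W| <= 2 * #|X|.
  have WX2 : 2 * #|W :\: X| <= #|W|.
    by rewrite -(leq_pmul2l (_ : 0 < 16 * z)) ?muln_gt0 //; nia.
  have := cardsD W X; rewrite (setIidPr XW); have := subset_leq_card XW; lia.
exists X; split=> // [|A A_obs].
  have -> : 128 * K * z * #|X| = 32 * K * z * (4 * #|X|) by ring.
  by apply: leq_trans VS _; rewrite leq_mul //; lia.
apply/negP => AX; have AW := subset_trans AX XW.
have /negP[] // : ~~ (A \subset W).
by apply: W_obs; rewrite inE A_obs (subset_trans AW WS).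
Qed.

Lemma exists_avoiding_set z L : 0 < z -> #|V| <= z ^ (2 * m) ->
  2 ^ (5 * L) <= 32 * z ->
  exists2 W : {set V}, avoids M W &
    L * #|V| <= 8192 * K * z ^ 2 * #|W|.
Proof.
move=> z_gt0 V_le L_le.
have [G_sym G_irr] := (@pair_graph_sym _ M, @pair_graph_irr _ M).
have [X [VX X_deg X_obs]] := exists_sparse_unobstructed z_gt0 V_le.
have X_indep : {in X, forall v, indep G (nbrs G X v)}.
  move=> v vX; apply: (indep_nbrs G_sym G_irr vX).
  by move=> B B_tri; apply: X_obs; rewrite inE B_tri orbT.
have [W] := exists_large_indep G_sym G_irr X_indep X_deg L_le.
rewrite !inE => /andP[WX /indepP W_indep] W_large; exists W.
  move=> A AM; apply/negP => AW; have /andP[] := M_card AM.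
  rewrite leq_eqVlt => /orP[/eqP A2 _|A_gt2 _]; last first.
    have /negP[] : ~~ (A \subset X) by apply: X_obs; rewrite !inE AM A_gt2.
    exact: subset_trans WX.
  have /cards2P[x [y [xy A_eq]]] : #|A| == 2 by rewrite -A2.
  move: AW AM; rewrite A_eq subUset !sub1set => /andP[xW yW] xyM.
  by have := W_indep x y xW yW; rewrite /pair_graph xy xyM.
apply: leq_trans (leq_mul (leqnn L) VX) _.
rewrite (_ : L * _ = 128 * K * z * (L * #|X|)); last by ring.
by apply: leq_trans (leq_mul (leqnn _) W_large) _; rewrite eq_leq //; ring.
Qed.
End AvoidingSet.

(** * Ramsey numbers *)

Definition ramsey_const r m := 8192 * density_const r ((2 * m * r).+1 ^ r) m.

Lemma ramsey_const_gt0 r m : 1 < m -> 0 < r -> 0 < ramsey_const r m.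
Proof. by move=> m_gt1 r_gt0; rewrite muln_gt0 density_const_gt0 ?expn_gt0. Qed.

Lemma exists_edge_free_set m r (H : uhypergraph r) z L :
  1 < m -> 1 < r -> 0 < z ->
  pattern_free (2 * m) (edges H) -> #|vertex H| <= z ^ (2 * m) ->
  2 ^ (5 * L) <= 32 * z ->
  exists2 W : {set vertex H}, avoids (edges H) W &
    L * #|vertex H| <= ramsey_const r m * z ^ 2 * #|W|.
Proof.
move=> m_gt1 r_gt1 z_gt0 H_free V_le L_le; pose q := 2 * m * r.
have K_free : pattern_free (2 * m) (kernels q H).
  by apply: kernels_pattern_free H_free => //; lia.
have K_card : {in kernels q H, forall A : {set vertex H}, 1 < #|A| <= r}.
  by move=> A AK; rewrite (card_kernel_gt1 AK) (card_kernel AK).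
have K_codeg x y : x != y ->
    codegree (kernels q H) [set x; y] <= q.+1 ^ r.
  by move=> xy; apply: codegree_kernels; rewrite cards2 xy // leq_addl.
have [||W W_free W_large] :=
  exists_avoiding_set m_gt1 _ _ K_card K_codeg K_free z_gt0 V_le L_le.
- exact: ltnW.
- by rewrite expn_gt0.
exists W => // e eH; apply/negP => eW.
have [A AK Ae] := edge_contains_kernel q r_gt1 eH.
by have /negP[] := W_free A AK; apply: subset_trans eW.
Qed.

Lemma contains_complete (V : finType) (E : {set {set V}}) r t (W : {set V}) :
  t <= #|W| -> (forall e : {set V}, e \subset W -> #|e| = r -> e \in E) ->
  contains_copy E (complete_uhypergraph r t).
Proof.
move=> tW W_edges; pose f (i : 'I_t) := enum_val (widen_ord tW i).
have f_inj : injective f by move=> i j /enum_val_inj/(congr1 val)/=/val_inj.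
exists f => // e; rewrite inE => /eqP e_card; apply: W_edges.
  by apply/subsetP => x /imsetP[i _ ->]; apply: enum_valP.
by rewrite card_imset.
Qed.

Lemma red_edges_uniform r n (c : {set 'I_n} -> bool) e :
  e \in [set e in complete_edges r n | c e] -> #|e| = r.
Proof. by rewrite inE => /andP[/complete_edges_uniform]. Qed.

Definition red_uhypergraph r n (c : {set 'I_n} -> bool) : uhypergraph r :=
  UHypergraph (@red_edges_uniform r n c).

Lemma ramsey_arrow_linear_cycle_complete m r (C : uhypergraph r) t z L :
  1 < m -> 1 < r -> is_linear_cycle (2 * m) C -> 0 < z ->
  2 ^ (5 * L) <= 32 * z -> ramsey_const r m * t <= L * z ^ (2 * m - 2) ->
  ramsey_arrow C (complete_uhypergraph r t) (z ^ (2 * m)).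
Proof.
move=> m_gt1 r_gt1 C_cycle z_gt0 L_le t_le c; set n := z ^ (2 * m).
have [|no_red] := EM (contains_copy [set e in complete_edges r n | c e] C).
  by left.
right; pose H := red_uhypergraph r c.
have k_ge4 : 4 <= 2 * m by lia.
have H_free : pattern_free (2 * m) (edges H).
  by apply: (pattern_free_of_no_copy k_ge4 C_cycle).
have V_le : #|vertex H| <= z ^ (2 * m) by rewrite card_ord.
have [W W_free W_large] :=
  exists_edge_free_set m_gt1 r_gt1 z_gt0 H_free V_le L_le.
apply: (@contains_complete _ _ _ _ W) => [|e eW e_card].
  have Kz_gt0 : 0 < ramsey_const r m * z ^ 2.
    by rewrite muln_gt0 expn_gt0 z_gt0 ramsey_const_gt0 // ltnW.
  rewrite -(leq_pmul2l Kz_gt0); apply: leq_trans W_large.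
  have -> : #|vertex H| = z ^ (2 * m - 2) * z ^ 2.
    by rewrite card_ord -expnD subnK //; lia.
  by rewrite mulnA mulnAC leq_mul.
have e_complete : e \in complete_edges r n by rewrite inE e_card.
rewrite inE e_complete /=; apply: contraL eW => e_red.
by apply: W_free; rewrite inE e_complete.
Qed.

Lemma exists_ramsey_number_le r (G H : uhypergraph r) n :
  0 < n -> ramsey_arrow G H n -> exists2 n', is_ramsey_number G H n' & n' <= n.
Proof.
move=> n_gt0 n_arrow; pose P i := (0 < i) && `[< ramsey_arrow G H i >].
have Pn : P n by rewrite /P n_gt0; apply/asboolP.
case: (ex_minnP (ex_intro _ n Pn)) => n' /andP[n'_gt0 /asboolP n'_arrow] n'_min.
exists n'; last exact: n'_min.
by split=> // i i_gt0 i_arrow; apply: n'_min; rewrite /P i_gt0; apply/asboolP.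
Qed.

(** * Choice of the parameters *)

Import Order.TTheory GRing.Theory Num.Theory.
Local Open Scope ring_scope.

Section RealEstimates.
Variable R : realType.
Implicit Types (x : R) (m K t z L d : nat).

Lemma ln_sqrt x : 0 < x -> ln x = 2 * ln (Num.sqrt x).
Proof.
move=> x_gt0; rewrite -{1}(sqr_sqrtr (ltW x_gt0)) lnXn ?sqrtr_gt0 //.
by rewrite mulr_natl.
Qed.

Lemma sqrt_le_scaled_div_ln a x :
  2 <= a -> 1 < x -> Num.sqrt x <= a * (x / ln x).
Proof.
move=> a_ge2 x_gt1; have x_gt0 : 0 < x by lra.
rewrite mulrA ler_pdivlMr ?ln_gt0 // (ln_sqrt x_gt0).
have s_gt0 : 0 < Num.sqrt x by rewrite sqrtr_gt0.
have := ln_sublinear s_gt0; have := sqr_sqrtr (ltW x_gt0).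
by move: (Num.sqrt x) s_gt0 => s s_gt0 <- ln_lt; nra.
Qed.

Lemma exists_exponent_ln z : (0 < z)%N ->
  exists2 L, (2 ^ (5 * L) <= 32 * z)%N & ln (z%:R : R) <= 5 * L%:R.
Proof.
move=> z_gt0; set l := trunc_log 2 (32 * z).
have /andP[l_le l_gt] : (2 ^ l <= 32 * z < 2 ^ l.+1)%N.
  by apply: trunc_log_bounds => //; rewrite muln_gt0.
exists (l %/ 5)%N.
  by apply: leq_trans l_le; rewrite leq_exp2l // mulnC leq_trunc_div.
have z_le : (z <= 2 ^ (5 * (l %/ 5)))%N.
  rewrite -(leq_pmul2l (isT : 0 < 32)%N); apply: leq_trans (ltnW l_gt) _.
  rewrite -(expnD 2 5) leq_exp2l //.
  by have := ltn_pmod l (isT : (0 < 5)%N); have := divn_eq l 5; lia.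
apply: le_trans (_ : ln (2 ^+ (5 * (l %/ 5))) <= _).
  by rewrite ler_ln ?posrE ?ltr0n ?exprn_gt0 // -natrX ler_nat.
rewrite lnXn // -[leLHS]mulr_natr natrM ler_piMl ?mulr_ge0 //.
by apply: (@le_ln1Dx _ 1); lra.
Qed.

Lemma exists_nat_root x d : (0 < d)%N -> 1 <= x ->
  exists z, [/\ (0 < z)%N, x <= z%:R ^+ d & z%:R <= 2 * x `^ d%:R^-1].
Proof.
move=> d_gt0 x_ge1; have x_gt0 : 0 < x by lra.
set y := x `^ _; have y_ge1 : 1 <= y.
  by rewrite -(powRr0 x) ler_powR // invr_ge0.
have /andP[y_ge y_lt] := truncn_itv (le_trans ler01 y_ge1).
exists (Num.Def.trunc y).+1; split=> //; last by rewrite -natr1; lra.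
have {1}-> : x = y ^+ d.
  rewrite -powR_mulrn ?powR_ge0 // -powRrM mulVf ?powRr1 // ?ltW //.
  by rewrite pnatr_eq0 -lt0n.
by rewrite lerXn2r ?nnegrE ?ltW // (lt_le_trans ltr01).
Qed.

(* The constant [20 * m] comes from [Num.sqrt x <= z ^ (2 * m - 2)], which
   bounds [ln x] by [4 * m * ln z], hence by [20 * m * L]. *)
Lemma mul_le_exponent_pow m K z L x : (1 < m)%N -> (0 < K)%N -> 1 < x ->
  (20 * m * K)%:R * (x / ln x) <= z%:R ^+ (2 * m - 2) ->
  ln (z%:R : R) <= 5 * L%:R ->
  K%:R * x <= L%:R * z%:R ^+ (2 * m - 2).
Proof.
move=> m_gt1 K_gt0 x_gt1 z_ge z_le; set d := (2 * m - 2)%N in z_ge *.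
have d_gt0 : (0 < d)%N by rewrite /d; lia.
have x_gt0 : 0 < x by lra.
have lnx_gt0 : 0 < ln x by rewrite ln_gt0.
have c_ge2 : 2 <= (20 * m * K)%:R :> R by rewrite ler_nat; nia.
have s_gt0 : 0 < Num.sqrt x by rewrite sqrtr_gt0.
have s_le := le_trans (sqrt_le_scaled_div_ln c_ge2 x_gt1) z_ge.
have zd_gt0 : 0 < z%:R ^+ d :> R by apply: lt_le_trans s_le.
have z_gt0 : 0 < z%:R :> R.
  rewrite lt0r ler0n andbT; apply: contraTneq zd_gt0 => ->.
  by rewrite expr0n (gtn_eqF d_gt0) ltxx.
have lnx_le : ln x <= (20 * m)%:R * L%:R.
  have : ln (Num.sqrt x) <= d%:R * ln z%:R.
    by rewrite mulr_natl -lnXn // ler_ln ?posrE.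
  have := ler_wpM2l (ler0n _ d) z_le; rewrite (ln_sqrt x_gt0).
  have : d%:R * (5 * L%:R) <= (10 * m)%:R * L%:R :> R.
    by rewrite -!natrM ler_nat /d; nia.
  rewrite [(10 * m)%:R]natrM [(20 * m)%:R]natrM; lra.
have -> : K%:R * x = (ln x / (20 * m)%:R) * ((20 * m * K)%:R * (x / ln x)).
  by rewrite (natrM _ _ K); field; rewrite gt_eqF //= pnatr_eq0 -lt0n; lia.
apply: ler_pM => //; first by rewrite divr_ge0 // ltW.
  by rewrite mulr_ge0 // divr_ge0 // ltW.
by rewrite ler_pdivrMr ?ltr0n ?muln_gt0 //= 1?mulrC //; lia.
Qed.

Lemma pow_double_root_le m z x : (1 < m)%N -> 0 <= x ->
  z%:R <= 2 * x `^ (2 * m - 2)%:R^-1 ->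
  z%:R ^+ (2 * m) <= 4 ^+ m * x `^ (m%:R / (m%:R - 1)).
Proof.
move=> m_gt1 x_ge0 z_le.
apply: le_trans (_ : (2 * x `^ (2 * m - 2)%:R^-1) ^+ (2 * m) <= _).
  by rewrite lerXn2r ?nnegrE ?mulr_ge0 ?powR_ge0.
rewrite exprMn exprM (_ : 2 ^+ 2 = 4) ?ler_wpM2l ?exprn_ge0 //; last by ring.
rewrite -powR_mulrn ?powR_ge0 // -powRrM natrB ?natrM; last by lia.
suff -> : (2 * m%:R - 2)^-1 * (2 * m%:R) = m%:R / (m%:R - 1) :> R by [].
have {}m_gt1 : 1 < m%:R :> R by rewrite ltr1n.
by field; apply/andP; split; rewrite gt_eqF //; lra.
Qed.

Lemma exists_parameters m K : (1 < m)%N -> (0 < K)%N ->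
  exists2 a : R, 0 < a & forall t, (1 < t)%N -> exists z L,
    [/\ (0 < z)%N, (2 ^ (5 * L) <= 32 * z)%N, (K * t <= L * z ^ (2 * m - 2))%N &
      (z ^ (2 * m))%:R <= a * (t%:R / ln t%:R) `^ (m%:R / (m%:R - 1))].
Proof.
move=> m_gt1 K_gt0; pose c : R := (20 * m * K)%:R.
have c_ge2 : 2 <= c by rewrite ler_nat; nia.
have c_gt0 : 0 < c by lra.
exists (4 ^+ m * c `^ (m%:R / (m%:R - 1))).
  by rewrite mulr_gt0 ?exprn_gt0 ?powR_gt0.
move=> t t_gt1; have T_gt1 : 1 < t%:R :> R by rewrite ltr1n.
have TlnT_ge0 : 0 <= t%:R / ln t%:R :> R by rewrite divr_ge0 // ln_ge0 // ltW.
have x_ge1 : 1 <= c * (t%:R / ln t%:R).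
  apply: le_trans (sqrt_le_scaled_div_ln c_ge2 T_gt1).
  by rewrite -[leLHS]sqrtr1; apply/ler_wsqrtr/ltW.
have d_gt0 : (0 < 2 * m - 2)%N by lia.
have [z [z_gt0 z_ge z_le]] := exists_nat_root d_gt0 x_ge1.
have [L L_le z_exp] := exists_exponent_ln z_gt0.
exists z, L; split=> //.
  rewrite -(ler_nat R) !natrM natrX.
  exact: mul_le_exponent_pow z_ge z_exp.
rewrite natrX -mulrA -(powRM _ (ltW c_gt0) TlnT_ge0).
by apply: pow_double_root_le z_le => //; apply: le_trans x_ge1.
Qed.
End RealEstimates.

Theorem theorem7p10 (R : realType) (m r : nat) (hm : (2 <= m)%N)
    (hr : (3 <= r)%N) :
  exists2 a : R, 0 < a &
    forall t : nat, (2 <= t)%N ->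
    forall C : uhypergraph r, is_linear_cycle (2 * m)%N C ->
    exists2 n : nat, is_ramsey_number C (complete_uhypergraph r t) n &
      n%:R <= a * (t%:R / ln t%:R) `^ (m%:R / (m%:R - 1)).
Proof.
have r_gt1 : (1 < r)%N by apply: ltnW.
have const_gt0 : (0 < ramsey_const r m)%N by rewrite ramsey_const_gt0 // ltnW.
have [a a_gt0 params] := exists_parameters R hm const_gt0.
exists a => // t t_gt1 C C_cycle.
have [z [L [z_gt0 L_le t_le z_le]]] := params t t_gt1.
have n_gt0 : (0 < z ^ (2 * m))%N by rewrite expn_gt0 z_gt0.
have arrow :=
  ramsey_arrow_linear_cycle_complete hm r_gt1 C_cycle z_gt0 L_le t_le.
have [n n_ramsey n_le] := exists_ramsey_number_le n_gt0 arrow.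
by exists n => //; apply: le_trans z_le; rewrite ler_nat.
Qed.
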